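(* Let $m\ge1$ be an integer, $\alpha\in(0,1)$, $\rho_1,\dots,\rho_m\in(0,1)$, and $\beta=1-(1-\alpha)^{1/m}$. For each $n$ let $\{1,\dots,n\}$ be partitioned into blocks $\mathcal I_1,\dots,\mathcal I_m$ with sizes $k_j=|\mathcal I_j|$, $\sum_{j=1}^m k_j=n$, and let $(X_1,\dots,X_n)$ be jointly Gaussian with $X_i\sim N(\mu_i,1)$, $\mu_i\ge0$, and correlation matrix $\Sigma_n$ given by $\operatorname{Corr}(X_i,X_{i'})=\rho_j$ if $i\ne i'$ both lie in $\mathcal I_j$, and $\operatorname{Corr}(X_i,X_{i'})=0$ if $i,i'$ lie in different blocks. Let $\mathcal I_{j0}=\{i\in\mathcal I_j:\mu_i=0\}$ and $k_{j0}=|\mathcal I_{j0}|$. Suppose $\min_j k_j\to\infty$ as $n\to\infty$. Then, for any configuration of true and false null hypotheses satisfying $\min_j\lim_{n\to\infty}\frac{k_{j0}}{k_j}>0$, the procedure that, for each $j$ and each $i\in\mathcal I_j$, rejects $\mathrm{H}_{0i}$ if $X_i>c_{k_j}(\beta,\rho_j)$ is asymptotically exact: $$\lim_{n\to\infty}\mathrm{FWER}^{III}(n,\alpha,\Sigma_n)=\lim_{n\to\infty}\mathbb{P}\left(\bigcup_{j=1}^m\bigcup_{i\in\mathcal I_{j0}}\{X_i>c_{k_j}(\beta,\rho_j)\}\right)=\alpha.$$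
   Context: $\Phi$ is the standard normal distribution function, and for an integer $k\ge2$, $b\in(0,1)$ and $r\in(0,1)$, $$c_k(b,r)=\sqrt{1-r}\,\Phi^{-1}\!\left(1-\tfrac1k\right)-\sqrt{r}\,\Phi^{-1}(b).$$ One tests $\mathrm{H}_{0i}:\mu_i=0$ versus $\mathrm{H}_{1i}:\mu_i>0$, $i=1,\dots,n$. $\mathrm{FWER}^{III}$ is the family-wise error rate of the stated procedure, i.e. the probability of at least one rejection of a true null hypothesis. The number of blocks $m$ and the $\rho_j$ do not depend on $n$; the block sizes, the blocks and the configuration of true nulls may. *)

(* Defs.v *)
From HB Require Import structures.
From mathcomp Require Export all_boot all_order all_algebra.
From mathcomp Require Export all_classical all_reals all_analysis.

Set Implicit Arguments.
Unset Strict Implicit.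
Unset Printing Implicit Defensive.

Import Order.TTheory GRing.Theory Num.Theory.
Import numFieldNormedType.Exports.

Local Open Scope classical_set_scope.
Local Open Scope ring_scope.

Definition Phi {R : realType} (x : R) : R :=
  fine (normal_prob (0 : R) 1 `]-oo, x]).

(* Phi is a bijection from R onto ]0, 1[ ; the value outside ]0, 1[ is 0. *)
Definition Phi_inv {R : realType} : R -> R := 'pinv_(fun=> 0) setT Phi.

(* Only meaningful for 2 <= k and b, r in ]0, 1[ (junk value otherwise). *)
Definition cutoff {R : realType} (k : nat) (b r : R) : R :=
  Num.sqrt (1 - r) * Phi_inv (1 - k%:R^-1) - Num.sqrt r * Phi_inv b.

(* Y ~ N(mean, sd^2).  The point mass is singled out because the library's
   normal_prob _ 0 is a dummy value (the uniform law on [0, 1]); only measurable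
   sets are tested, the other ones having no meaningful probability. *)
Definition has_normal_law d (T : measurableType d) (R : realType)
    (P : probability T R) (Y : T -> R) (mean sd : R) : Prop :=
  forall A : set R, measurable A ->
    P (Y @^-1` A) = if sd == 0 then \d_mean A else normal_prob mean sd A.

(* Every linear combination is normal, possibly degenerate. *)
Definition jointly_gaussian d (T : measurableType d) (R : realType)
    (P : probability T R) (n : nat) (X : 'I_n -> {RV P >-> R}) : Prop :=
  forall a : 'I_n -> R, exists mean sd : R,
    0 <= sd /\ has_normal_law P (fun w => \sum_(i < n) a i * X i w) mean sd.

Definition correlation d (T : measurableType d) (R : realType)
    (P : probability T R) (X Y : T -> R) : R :=
  fine (covariance P X Y) / (Num.sqrt (fine 'V_P[X]) * Num.sqrt (fine 'V_P[Y])).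

(* [proc] maps the observed data to the set of indices of rejected hypotheses. *)
Definition FWER d (T : measurableType d) (R : realType) (P : probability T R)
    (n : nat) (X : 'I_n -> {RV P >-> R}) (true_nulls : {set 'I_n})
    (proc : ('I_n -> R) -> {set 'I_n}) : \bar R :=
  P [set w | exists i, i \in true_nulls /\ i \in proc (fun i' => X i' w)].

Definition block_procedure {R : realType} (n m : nat) (I : 'I_m -> {set 'I_n})
    (beta : R) (rho : 'I_m -> R) (x : 'I_n -> R) : {set 'I_n} :=
  [set i | [exists j, (i \in I j) && (cutoff #|I j| beta (rho j) < x i)]]%SET.

Definition true_nulls_in {R : realType} (n : nat) (mu : 'I_n -> R)
    (B : {set 'I_n}) : {set 'I_n} :=
  [set i in B | mu i == 0]%SET.

(* Main.v *)
(* Only the true nulls matter.  In each block subtract from every X_i a multiple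
   of the block average, the multiple being chosen so that the residuals are
   exactly uncorrelated; block averages of different blocks are uncorrelated
   too, and uncorrelated jointly normal variables are independent.  With q the
   (1 - 1/k)-quantile, the maximum of the standardized residuals of a block lies
   within 1 / sqrt q of q with probability tending to 1, because k0 / k stays
   bounded away from 0.  Hence block j has no rejection essentially when
   its average is at most - sqrt rho_j Phi^-1(beta), which has probability
   tending to 1 - beta, and the product over the blocks is 1 - alpha.

   Independence is obtained without Fourier inversion: trigonometric polynomials
   in Y approximate the indicator of a half-line boundedly and pointwise off the
   end point, so a bounded D orthogonal to all cos (a Y + b) is orthogonal to
   that indicator.  The characteristic function of the normal law follows from
   integration by parts. *)
Require Import Defs.
From mathcomp Require Import measurable_realfun ring lra.

Set Implicit Arguments.
Unset Strict Implicit.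
Unset Printing Implicit Defensive.

Import Order.TTheory GRing.Theory Num.Theory.
Import numFieldNormedType.Exports.

Local Open Scope classical_set_scope.
Local Open Scope ring_scope.

(** Let u be the standard deviation of the average of the true nulls of a block and Z the
    standardized average. Two residuals X_i - c Z have covariance rho - 2 c u + c^2, and the
    coefficient used is the root c = u - sqrt (u^2 - rho). The residuals of one block are then
    independent, but each keeps the positive covariance u - c with its own Z. Independence is
    therefore used only inside two kinds of families, the averages of all blocks and the residuals
    of one block. Union bounds join the two: the exceptional events of the residuals have
    probability tending to 0, whatever their dependence on the averages.

    The window delta = 1 / sqrt q meets two opposite demands. It tends to 0, so it shifts the
    threshold of the average negligibly; and delta * q = sqrt q tends to infinity, so moving from q
    by delta in either direction changes the tail 1 / k by a factor of order exp (sqrt q), which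
    outweighs the bounded ratio k / k0. *)

(** * Integrals against the normal law and over the whole line *)

Section normal_prob_integral.
Variables (R : realType) (m s : R).
Local Notation mu := (@lebesgue_measure R).

(* The Radon-Nikodym derivative of the normal law is its density. *)
Lemma normal_prob_ge0_integral (f : R -> \bar R) :
  measurable_fun setT f -> (forall x, 0 <= f x)%E ->
  (\int[normal_prob m s]_x f x = \int[mu]_x (f x * (normal_pdf m s x)%:E))%E.
Proof.
move=> mf f0.
have dom := @normal_prob_dominates R m s.
rewrite -(Radon_Nikodym_SigmaFinite.change_of_variables dom)//=.
apply: ae_eq_integral => //.
- apply: emeasurable_funM => //; apply: (measurable_int mu).
  exact: Radon_Nikodym_SigmaFinite.f_integrable.
- apply: emeasurable_funM => //=; apply/measurableT_comp => //=.
  exact: measurable_normal_pdf.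
- apply: ae_eqe_mul2l => /=.
  apply: integral_ae_eq => //=.
  + exact: Radon_Nikodym_SigmaFinite.f_integrable.
  + by apply/measurableT_comp => //; exact: measurable_normal_pdf.
  + by move=> E _ mE; rewrite -Radon_Nikodym_SigmaFinite.f_integral.
Qed.

Lemma normal_prob_integrable (f : R -> R) : measurable_fun setT f ->
  mu.-integrable [set: R] (fun x => (f x * normal_pdf m s x)%:E) ->
  (normal_prob m s).-integrable [set: R] (EFin \o f).
Proof.
move=> mf /integrableP[_ fi]; apply/integrableP; split.
  exact/measurable_EFinP.
rewrite normal_prob_ge0_integral//; last first.
  by apply: measurableT_comp => //; exact/measurable_EFinP.
apply: le_lt_trans fi; rewrite le_eqVlt; apply/orP; left; apply/eqP.
apply: eq_integral => x _ /=.
by rewrite normrM EFinM (ger0_norm (normal_pdf_ge0 _ _ _)).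
Qed.

Lemma normal_prob_Rintegral (f : R -> R) : measurable_fun setT f ->
  mu.-integrable [set: R] (fun x => (f x * normal_pdf m s x)%:E) ->
  \int[normal_prob m s]_x f x = \int[mu]_x (f x * normal_pdf m s x).
Proof.
move=> mf fi; rewrite /Rintegral; congr fine.
have mf' : measurable_fun setT (EFin \o f) by exact/measurable_EFinP.
rewrite integralE [RHS]integralE; congr (_ - _)%E.
- rewrite normal_prob_ge0_integral//; last exact: measurable_funepos.
  apply: eq_integral => x _; rewrite !funeposE/= -!EFin_max -EFinM.
  by rewrite maxr_pMl ?normal_pdf_ge0// mul0r.
- rewrite normal_prob_ge0_integral//; last exact: measurable_funeneg.
  apply: eq_integral => x _; rewrite !funenegE/= -!EFin_max -EFinM.
  by rewrite maxr_pMl ?normal_pdf_ge0// mul0r mulNr.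
Qed.

End normal_prob_integral.

(** Fundamental theorem of calculus on growing windows, then dominated convergence with bound |f|.
    The windows are centred at [m], later the mean, so that decay estimates in (x - m)^2 apply at
    both ends. *)
Lemma Rintegral_derive_eq0 (R : realType) (F f : R -> R) (m : R) :
  continuous f -> (forall x : R, is_derive x 1 F (f x)) ->
  (@lebesgue_measure R).-integrable [set: R] (EFin \o f) ->
  F (m + n%:R) @[n --> \oo] --> (0 : R) ->
  F (m - n%:R) @[n --> \oo] --> (0 : R) ->
  \int[@lebesgue_measure R]_x f x = 0.
Proof.
move=> cf dF fi Fp Fn.
have mf : measurable_fun setT (EFin \o f) by exact: measurable_int fi.
pose A n : set R := [set` `[m - n%:R, m + n%:R]].
have mA n : measurable (A n) by exact: measurable_itv.
have [||||| _ _ lim1] := @dominated_convergence _ _ _ (@lebesgue_measure R) setT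
  measurableT (fun n => (EFin \o f) \_ (A n)) (EFin \o f) (abse \o (EFin \o f)) => //.
- by move=> n; apply/(measurable_restrictT _ _).1; [exact: mA|exact: measurable_funTS].
- apply: aeW => x _; apply: cvg_near_cst.
  near=> n; rewrite patchE ifT// inE /A/= in_itv/=.
  rewrite -ler_distl.
  by near: n; exact: nbhs_infty_ger.
- exact: integrable_abse.
- apply: aeW => x n _; rewrite patchE; case: ifPn => //= _.
  by rewrite normr0 lee_fin.
have lim2 : (F (m + n%:R) - F (m - n%:R))%:E @[n --> \oo] --> (0 : R)%:E.
  apply/cvg_EFin; first exact: nearW.
  by rewrite -(subr0 (0 : R)); exact: cvgB.
suff : (\int[@lebesgue_measure R]_x (EFin \o f) x = 0)%E.
  by move=> /(congr1 fine).
apply: (cvg_unique _ lim1) => //.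
apply: cvg_trans lim2; apply: near_eq_cvg; near=> n.
have n0 : (0 < n%:R :> R).
  by rewrite ltr0n; near: n; exact: nbhs_infty_gt.
rewrite -[RHS]integral_mkcond /A (continuous_FTC2 (F := F))//.
- by lra.
- exact: continuous_subspaceT.
- have cF : continuous F.
    by move=> x; apply/differentiable_continuous/derivable1_diffP.
  split => [x _ //||].
  + by apply: cvg_at_right_filter; exact: cF.
  + by apply: cvg_at_left_filter; exact: cF.
- by move=> x _; rewrite derive1E derive_val.
Unshelve. all: by end_near. Qed.

Lemma normr_le1Dsqr (R : realType) (x : R) : `|x| <= 1 + x ^+ 2.
Proof.
rewrite -(real_normK (num_real x)); have := normr_ge0 x.
by have := sqr_ge0 (`|x| - 1); nra.
Qed.

(** * Gaussian decay estimates, integration by parts and moments *)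

Section normal_prob_moments.
Variables (R : realType) (m s : R).
Hypothesis s_gt0 : 0 < s.
Local Notation mu := (@lebesgue_measure R).
Implicit Types (x : R) (h g : R -> R).

Let K := 1 + 4 * s ^+ 2.
Let c := normal_peak s.

Let K_gt0 : 0 < K.
Proof. by rewrite ltr_wpDr// mulr_ge0// sqr_ge0. Qed.

(** The exponent of the density is split into two equal halves, one of which absorbs a quadratic
    factor: with u = (x - m)^2 / (4 s^2), 1 + (x - m)^2 = 1 + 4 s^2 u <= K (1 + u) <= K exp u. *)
Let half_exp x : (1 + (x - m) ^+ 2) * expR (- ((x - m) ^+ 2 / (4 * s ^+ 2))) <= K.
Proof.
set y := x - m; set u := y ^+ 2 / _.
have s2 : 0 < s ^+ 2 by rewrite exprn_gt0.
have u0 : 0 <= u by rewrite divr_ge0 ?sqr_ge0//; lra.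
rewrite expRN ler_pdivrMr ?expR_gt0//.
apply: (@le_trans _ _ (K * (1 + u))).
  have -> : y ^+ 2 = u * (4 * s ^+ 2) by rewrite divfK//; lra.
  by rewrite /K; nra.
by rewrite ler_pM2l ?expR_ge1Dx.
Qed.

Let pdfE x : normal_pdf m s x =
  c * (expR (- ((x - m) ^+ 2 / (4 * s ^+ 2))) * expR (- ((x - m) ^+ 2 / (4 * s ^+ 2)))).
Proof.
rewrite normal_pdfE ?gt_eqF// /normal_fun; congr (_ * _).
rewrite -expRD; congr expR; field.
by rewrite gt_eqF.
Qed.

Let c_gt0 : 0 < c.
Proof. by rewrite normal_peak_gt0 ?gt_eqF. Qed.

(** Each half of the exponent absorbs one factor 1 + (x - m)^2. This controls the boundary terms of
    the integration by parts. *)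
Lemma normal_pdf_vanish x :
  (1 + (x - m) ^+ 2) * normal_pdf m s x <= c * K ^+ 2 / (1 + (x - m) ^+ 2).
Proof.
have y0 := sqr_ge0 (x - m).
rewrite ler_pdivlMr; last by lra.
rewrite pdfE; move: (half_exp x); set e := expR _ => he.
have e0 : 0 <= e by exact: expR_ge0.
rewrite (_ : _ * _ * _ = c * ((1 + (x - m) ^+ 2) * e) ^+ 2); last by ring.
by rewrite ler_pM2l// lerXn2r ?nnegrE ?(ltW K_gt0)// mulr_ge0//; lra.
Qed.

(** One half of the exponent absorbs the growth of [h]; the other half is, up to a constant, the
    normal density with standard deviation sqrt 2 * s, which serves as dominating function. [D]
    collects the constants. *)
Lemma normal_pdf_integrable h (C : R) : measurable_fun [set: R] h ->
  (forall x, `|h x| <= C * (1 + (x - m) ^+ 2)) ->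
  mu.-integrable [set: R] (fun x => (h x * normal_pdf m s x)%:E).
Proof.
move=> mh hC.
have s'0 : Num.sqrt 2 * s != 0 by rewrite mulf_neq0 ?gt_eqF ?sqrtr_gt0.
have C0 : 0 <= C.
  have := hC m; rewrite subrr expr0n addr0 mulr1; exact: le_trans.
have := integrable_normal_pdf m (Num.sqrt 2 * s).
pose D := C * c * K / normal_peak (Num.sqrt 2 * s).
have D0 : 0 <= D.
  rewrite /D divr_ge0 ?normal_peak_ge0//.
  by rewrite !mulr_ge0 ?(ltW K_gt0) ?(ltW c_gt0).
move/(integrableZl measurableT D); apply: le_integrable => //.
  apply/measurable_EFinP; apply: measurable_funM => //.
  exact: measurable_normal_pdf.
move=> x _; rewrite lee_fin [leLHS]normrM (ger0_norm (normal_pdf_ge0 _ _ _)).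
rewrite [leRHS]ger0_norm; last exact: mulr_ge0 D0 (normal_pdf_ge0 _ _ _).
rewrite (normal_pdfE m s'0) mulrA /D divfK; last first.
  by rewrite gt_eqF// normal_peak_gt0.
rewrite pdfE /normal_fun.
rewrite (_ : - (x - m) ^+ 2 / _ = - ((x - m) ^+ 2 / (4 * s ^+ 2))); last first.
  by rewrite exprMn sqr_sqrtr//; field; rewrite gt_eqF.
move: (half_exp x) (hC x); set e := expR _ => he hx.
have e0 : 0 <= e by exact: expR_ge0.
apply: (@le_trans _ _ (C * (1 + (x - m) ^+ 2) * (c * (e * e)))).
  by rewrite ler_wpM2r// !mulr_ge0// ltW.
rewrite (_ : _ * _ = (C * c * e) * ((1 + (x - m) ^+ 2) * e)); last by ring.
rewrite (_ : C * c * K * e = (C * c * e) * K); last by ring.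
by rewrite ler_wpM2l// !mulr_ge0// ltW.
Qed.

Lemma is_derive_normal_pdf x :
  is_derive x 1 (normal_pdf m s) (- ((x - m) / s ^+ 2) * normal_pdf m s x).
Proof.
rewrite normal_pdfE ?gt_eqF// /normal_fun.
apply: is_derive_eq.
rewrite /GRing.scale/=; field.
by rewrite gt_eqF.
Qed.

End normal_prob_moments.

Section normal_prob_stein.
Variables (R : realType) (m s : R).
Hypothesis s_gt0 : 0 < s.
Local Notation mu := (@lebesgue_measure R).
Local Notation N := (normal_prob m s).
Implicit Types (x : R) (h g : R -> R).

Lemma normal_prob_integrable_quadratic h (C : R) : measurable_fun [set: R] h ->
  (forall x, `|h x| <= C * (1 + (x - m) ^+ 2)) ->
  N.-integrable [set: R] (EFin \o h).
Proof.
by move=> mh hC; apply: normal_prob_integrable => //; exact: normal_pdf_integrable hC.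
Qed.

Lemma cvg_quadratic_inv (C : R) : C / (1 + n%:R ^+ 2) @[n --> \oo] --> 0.
Proof.
have h1 : (2 * `|C|) * n.+1%:R^-1 @[n --> \oo] --> 0.
  by rewrite -(mulr0 (2 * `|C|)); apply: cvgM; [exact: cvg_cst|exact: cvg_harmonic].
apply: norm_cvg0; apply: (squeeze_cvgr _ (cvg_cst 0) h1); near=> n => /=.
rewrite normr_ge0/= normrM normfV (@ger0_norm _ (1 + _)) ?addr_ge0 ?sqr_ge0//.
rewrite ler_pdivlMr// mulrAC ler_pdivrMr; last first.
  by rewrite ltr_wpDr ?sqr_ge0.
rewrite [2 * _]mulrC -mulrA ler_wpM2l// -natr1; set a : R := n%:R.
by have := sqr_ge0 (a - 1); nra.
Unshelve. all: by end_near. Qed.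

(* Integration by parts against the density p, using p' = - (x - m) / s ^ 2 * p. *)
Lemma normal_prob_stein g g' (C : R) :
  (forall x, is_derive x 1 g (g' x)) -> continuous g' ->
  (forall x, `|g x| <= C * (1 + (x - m) ^+ 2)) ->
  (forall x, `|g' x| <= C * (1 + (x - m) ^+ 2)) ->
  (forall x, `|g x * (x - m)| <= C * (1 + (x - m) ^+ 2)) ->
  \int[N]_x (g x * (x - m)) = s ^+ 2 * \int[N]_x g' x.
Proof.
move=> dg cg' bg bg' bgx.
have cg : continuous g.
  by move=> x; apply/differentiable_continuous/derivable1_diffP; exact: ex_derive.
have cgx : continuous (fun x => g x * (x - m)).
  by move=> x; apply: cvgM; [exact: cg|apply: cvgB; [exact: cvg_id|exact: cvg_cst]].
have mg' : measurable_fun [set: R] g' by exact: continuous_measurable_fun.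
have mgx : measurable_fun [set: R] (fun x => g x * (x - m)).
  exact: continuous_measurable_fun.
have s2 : s ^+ 2 != 0 by rewrite expf_neq0// gt_eqF.
have i1 := normal_pdf_integrable s_gt0 mg' bg'.
have i2 := normal_pdf_integrable s_gt0 mgx bgx.
rewrite !normal_prob_Rintegral//.
apply/eqP; rewrite eq_sym -subr_eq0 -RintegralZl//.
rewrite -RintegralB//; last first.
  by rewrite /comp; under eq_fun do rewrite EFinM; exact: integrableZl.
(* This is the derivative of s^2 * g * p, so the identity says that its integral vanishes. *)
pose f x := s ^+ 2 * (g' x * normal_pdf m s x) - g x * (x - m) * normal_pdf m s x.
apply/eqP; apply: (@Rintegral_derive_eq0 _ (fun x => s ^+ 2 * (g x * normal_pdf m s x)) f m).
- have cp := @continuous_normal_pdf R m s (lt0r_neq0 s_gt0).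
  move=> x; apply: cvgB; apply: cvgM.
  + exact: cvg_cst.
  + by apply: cvgM; [exact: cg'|exact: cp].
  + exact: cgx.
  + exact: cp.
- move=> x; have := is_derive_normal_pdf m s_gt0 x; move: (dg x) => dgx dpx.
  apply: is_derive_eq; rewrite /f /GRing.scale/=; field.
  by rewrite gt_eqF.
- rewrite /f /comp; under eq_fun do rewrite EFinB; apply: integrableB => //.
  by rewrite /comp; under eq_fun do rewrite EFinM; exact: integrableZl.
(* Boundary term at distance n from the mean: the quadratic growth of g against [normal_pdf_vanish]
   leaves a multiple of 1 / (1 + n^2). *)
- rewrite -(mulr0 (s ^+ 2)); apply: cvgM; first exact: cvg_cst.
  have := @cvg_quadratic_inv (C * (normal_peak s * (1 + 4 * s ^+ 2) ^+ 2)).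
  move=> h; apply: norm_cvg0; apply: (squeeze_cvgr _ (cvg_cst 0) h); near=> n => /=.
  have := bg (m + n%:R); have := normal_pdf_vanish m s_gt0 (m + n%:R).
  rewrite normr_ge0/= (addrC m) addrK => h1 h2.
  rewrite normrM (ger0_norm (normal_pdf_ge0 _ _ _)).
  apply: le_trans (ler_wpM2r (normal_pdf_ge0 _ _ _) h2) _.
  rewrite -[leLHS]mulrA -[leRHS]mulrA ler_wpM2l//.
  have := bg m; rewrite subrr expr0n addr0 mulr1; exact: le_trans.
- rewrite -(mulr0 (s ^+ 2)); apply: cvgM; first exact: cvg_cst.
  have := @cvg_quadratic_inv (C * (normal_peak s * (1 + 4 * s ^+ 2) ^+ 2)).
  move=> h; apply: norm_cvg0; apply: (squeeze_cvgr _ (cvg_cst 0) h); near=> n => /=.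
  have := bg (m - n%:R); have := normal_pdf_vanish m s_gt0 (m - n%:R).
  rewrite normr_ge0/= (addrC m) addrK sqrrN => h1 h2.
  rewrite normrM (ger0_norm (normal_pdf_ge0 _ _ _)).
  apply: le_trans (ler_wpM2r (normal_pdf_ge0 _ _ _) h2) _.
  rewrite -[leLHS]mulrA -[leRHS]mulrA ler_wpM2l//.
  have := bg m; rewrite subrr expr0n addr0 mulr1; exact: le_trans.
Unshelve. all: by end_near. Qed.

Lemma normal_prob_centered_mean : \int[N]_x (x - m) = 0.
Proof.
have := @normal_prob_stein (cst 1) (cst 0) 1.
rewrite Rintegral_cst// mul0r mulr0.
under eq_Rintegral do rewrite /= mul1r.
apply.
- by move=> x; exact: cvg_cst.
- by move=> x; rewrite normr1 mul1r lerDl sqr_ge0.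
- by move=> x; rewrite normr0 mul1r addr_ge0 ?sqr_ge0.
- by move=> x; rewrite !mul1r; exact: normr_le1Dsqr.
Qed.

Lemma normal_prob_centered_second_moment :
  \int[N]_x ((x - m) ^+ 2) = s ^+ 2.
Proof.
have := @normal_prob_stein (fun x => x - m) (cst 1) 1.
rewrite Rintegral_cst// (_ : fine _ = 1) ?mulr1; last first.
  by have /(congr1 fine) := @probability_setT _ _ _ (normal_prob m s).
apply.
- by move=> x; apply: is_derive_eq; rewrite subr0.
- by move=> x; exact: cvg_cst.
- by move=> x; rewrite mul1r normr_le1Dsqr.
- by move=> x; rewrite normr1 mul1r lerDl sqr_ge0.
- by move=> x; rewrite -expr2 mul1r ger0_norm ?sqr_ge0// lerDr.
Qed.

End normal_prob_stein.

(** * The characteristic function of the normal law, in real form *)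

Section normal_prob_cos.
Variables (R : realType) (m s : R).
Hypothesis s_gt0 : 0 < s.
Local Notation N := (normal_prob m s).
Implicit Types (x t b : R).

Let f b t x := cos (t * (x - m) + b).

Let derf b t x : is_derive t 1 (f b ^~ x) (- (x - m) * sin (t * (x - m) + b)).
Proof.
rewrite /f; apply: is_derive_eq.
by rewrite /GRing.scale/= !(mulr0,addr0,mulr1,add0r) mulrC mulNr mulrN.
Qed.

Let mf b t : measurable_fun [set: R] (f b t).
Proof.
apply: continuous_measurable_fun => x; apply: continuous_comp; last exact: continuous_cos.
apply: cvgD; last exact: cvg_cst.
by apply: cvgM; [exact: cvg_cst|apply: cvgB; [exact: cvg_id|exact: cvg_cst]].
Qed.

Let intf b t : N.-integrable [set: R] (EFin \o f b t).
Proof.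
apply: (normal_prob_integrable_quadratic s_gt0 (C := 1)) => // x.
by rewrite mul1r (le_trans (cos_max _))// lerDl sqr_ge0.
Qed.

Let F b t := \int[N]_x f b t x.

(** Differentiation under the integral sign, dominated by |x - m|, brings down the factor x - m;
    integration by parts with g = sin (t (x - m) + b) turns the result back into a multiple of F. *)
Let dF b t : is_derive t 1 (F b) (- (s ^+ 2 * t) * F b t).
Proof.
have It : `]t - 1, t + 1[%classic t by rewrite /= in_itv/=; lra.
have iG : N.-integrable [set: R] (EFin \o (fun x => `|x - m|)).
  apply: (normal_prob_integrable_quadratic s_gt0 (C := 1)).
    by apply: measurableT_comp => //; exact: measurable_funB.
  by move=> x; rewrite normr_id mul1r normr_le1Dsqr.
have d1 x y : derivable (f b ^~ y) x 1 by apply: ex_derive; exact: derf.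
have bG x y : `|partial1of2 (f b) x y| <= `|y - m|.
  rewrite partial1of2E.
  have -> := @derive_val _ _ _ _ _ _ _ (derf b x y).
  by rewrite normrM normrN -[leRHS]mulr1 ler_wpM2l// sin_max.
have h1 := @derivable_under_integral R _ _ N (f b) [set: R] measurableT t _ _ It
  (fun x _ => intf b x) (fun x y _ _ => d1 x y) _ (fun y => normr_ge0 (y - m))
  iG (fun x y _ _ => bG x y).
have h2 := @differentiation_under_integral R _ _ N (f b) [set: R] measurableT t _ _ It
  (fun x _ => intf b x) (fun x y _ _ => d1 x y) _ (fun y => normr_ge0 (y - m))
  iG (fun x y _ _ => bG x y).
apply: DeriveDef; first exact: h1.
rewrite -derive1E [LHS]h2.
transitivity (\int[N]_x (- 1 * (sin (t * (x - m) + b) * (x - m)))).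
  apply: eq_Rintegral => x _; rewrite partial1of2E.
  by rewrite (@derive_val _ _ _ _ _ _ _ (derf b t x)); ring.
have csin : continuous (fun x => sin (t * (x - m) + b)).
  move=> x; apply: continuous_comp; last exact: continuous_sin.
  apply: cvgD; last exact: cvg_cst.
  by apply: cvgM; [exact: cvg_cst|apply: cvgB; [exact: cvg_id|exact: cvg_cst]].
have bx x : `|sin (t * (x - m) + b) * (x - m)| <= 1 * (1 + (x - m) ^+ 2).
  by rewrite normrM mul1r (le_trans _ (normr_le1Dsqr _))// ler_piMl// sin_max.
rewrite RintegralZl//; last first.
  apply: (normal_prob_integrable_quadratic s_gt0) bx.
  apply: continuous_measurable_fun => x; apply: cvgM; first exact: csin.
  by apply: cvgB; [exact: cvg_id|exact: cvg_cst].
(* One constant must bound both the sine, by 1, and its derivative, by |t|. *)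
pose C := 1 + `|t|.
have C1 : 1 <= C by rewrite lerDl.
have le1C x : 1 * (1 + (x - m) ^+ 2) <= C * (1 + (x - m) ^+ 2).
  by rewrite ler_wpM2r ?addr_ge0 ?sqr_ge0.
have q0 x : 1 <= 1 + (x - m) ^+ 2 by rewrite lerDl sqr_ge0.
have dsin x : is_derive x 1 (fun x => sin (t * (x - m) + b)) (t * f b t x).
  apply: is_derive_eq.
  by rewrite /f /GRing.scale/= !(mulr0,addr0,mulr1,add0r,subr0) mulrC.
rewrite (normal_prob_stein s_gt0 (C := C) dsin).
- by rewrite RintegralZl// /F; ring.
- move=> x; apply: cvgM; first exact: cvg_cst.
  apply: continuous_comp; last exact: continuous_cos.
  apply: cvgD; last exact: cvg_cst.
  by apply: cvgM; [exact: cvg_cst|apply: cvgB; [exact: cvg_id|exact: cvg_cst]].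
- by move=> x; rewrite (le_trans _ (le1C x))// mul1r (le_trans (sin_max _)).
- move=> x; rewrite normrM (@le_trans _ _ (`|t| * 1))//.
    by rewrite ler_wpM2l// cos_max.
  by rewrite ler_pM// lerDr.
- by move=> x; exact: le_trans (bx x) (le1C x).
Qed.

(** The linear differential equation [dF] is solved with the integrating factor exp ((u s)^2 / 2).
    The free phase [b] covers the real and imaginary parts of the complex exponential together. *)
Lemma normal_prob_cos t b :
  \int[N]_x cos (t * (x - m) + b) = cos b * expR (- (t * s) ^+ 2 / 2).
Proof.
pose H u : R := F b u * expR ((u * s) ^+ 2 / 2).
have dH (u : R) : is_derive u 1 H 0.
  have := dF b u => h.
  rewrite /H; apply: is_derive_eq.
  by rewrite /GRing.scale/=; field.
have := @is_derive_0_is_cst _ H t 0 dH.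
rewrite /H mul0r expr0n mul0r expR0 mulr1.
have -> : F b 0 = cos b.
  rewrite /F /f; under eq_Rintegral do rewrite mul0r add0r.
  rewrite Rintegral_cst// (_ : fine _ = 1) ?mulr1//.
  by have /(congr1 fine) := @probability_setT _ _ _ (normal_prob m s).
by move=> <-; rewrite mulNr expRN mulfK// gt_eqF// expR_gt0.
Qed.

End normal_prob_cos.

(** * Transfer of integrals from a random variable to its law *)

Section law_integral.
Context d (T : measurableType d) (R : realType) (P : probability T R).
Variables (Y : T -> measurableTypeR R) (Q : {measure set (measurableTypeR R) -> \bar R}).
Hypotheses (mY : measurable_fun setT Y)
  (PYQ : forall A : set (measurableTypeR R), measurable A -> P (Y @^-1` A) = Q A).

Lemma law_ge0_integral (f : measurableTypeR R -> \bar R) : measurable_fun [set: measurableTypeR R] f ->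
  (forall x, 0 <= f x)%E -> (\int[P]_w f (Y w) = \int[Q]_x f x)%E.
Proof.
move=> mf f0;
have := @ge0_integral_pushforward _ _ _ _ _ _ mY P setT f measurableT mf (fun y _ => f0 y).
rewrite preimage_setT => h; rewrite -[LHS]h.
by apply: eq_measure_integral => A mA _; exact: PYQ.
Qed.

Lemma law_integrable (h : measurableTypeR R -> R) : Q.-integrable [set: measurableTypeR R] (EFin \o h) ->
  P.-integrable setT (fun w => (h (Y w))%:E).
Proof.
move=> /integrableP[/measurable_EFinP mh hi]; apply/integrableP; split.
  by apply/measurable_EFinP; exact: (measurableT_comp mh mY).
rewrite (law_ge0_integral (f := fun x => `|(h x)%:E|%E))//.
by apply/measurable_EFinP/measurableT_comp.
Qed.

Lemma law_Rintegral (h : measurableTypeR R -> R) : measurable_fun [set: measurableTypeR R] h ->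
  \int[P]_w h (Y w) = \int[Q]_x h x.
Proof.
move=> /measurable_EFinP mh; rewrite /Rintegral; congr fine.
rewrite integralE [RHS]integralE; congr (_ - _)%E.
- transitivity (\int[P]_w (EFin \o h)^\+ (Y w))%E.
    by apply: eq_integral => w _; rewrite !funeposE.
  by apply: law_ge0_integral => //; exact: measurable_funepos.
- transitivity (\int[P]_w (EFin \o h)^\- (Y w))%E.
    by apply: eq_integral => w _; rewrite !funenegE.
  by apply: law_ge0_integral => //; exact: measurable_funeneg.
Qed.

End law_integral.

Section normal_law.
Context d (T : measurableType d) (R : realType) (P : probability T R).
Variables (Y : T -> R) (m s : R).
Hypotheses (mY : measurable_fun setT Y) (s_ge0 : 0 <= s)
  (lawY : has_normal_law P Y m s).

(** Linear combinations may degenerate, for instance when all coefficients vanish, so each transfer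
    has a point-mass case and a normal case. The resulting formulas agree, with s = 0 in the
    former. *)
Let law0 : s = 0 -> forall A : set (measurableTypeR R), measurable A -> P (Y @^-1` A) = @dirac _ (measurableTypeR R) m R A.
Proof. by move=> s0 A mA; rewrite lawY// s0 eqxx. Qed.

Let law1 : 0 < s ->
  forall A : set (measurableTypeR R), measurable A -> P (Y @^-1` A) = normal_prob m s A.
Proof. by move=> s0 A mA; rewrite lawY// gt_eqF. Qed.

Lemma normal_law_integrable (h : R -> R) (C : R) : measurable_fun [set: R] h ->
  (forall x, `|h x| <= C * (1 + (x - m) ^+ 2)) ->
  P.-integrable setT (fun w => (h (Y w))%:E).
Proof.
move=> mh hC; have [s0|s0] := eqVneq s 0.
  apply: (law_integrable mY (law0 s0)).
  have mh' : measurable_fun [set: R] (EFin \o h) by exact/measurable_EFinP.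
  apply/integrableP; split => //.
  rewrite integral_dirac//; last exact: measurableT_comp.
  by rewrite diracT mul1e ltry.
have {}s0 : 0 < s by rewrite lt0r s0.
apply: (law_integrable mY (law1 s0)).
exact: normal_prob_integrable_quadratic hC.
Qed.

Let dirac_int (h : R -> R) : measurable_fun [set: R] h ->
  \int[@dirac _ (measurableTypeR R) m R]_x h x = h m.
Proof.
move=> /measurable_EFinP mh.
by rewrite /Rintegral [X in fine X]integral_dirac// diracT mul1e.
Qed.

Lemma normal_law_cos (t b : R) :
  \int[P]_w cos (t * Y w + b) = cos (t * m + b) * expR (- (t * s) ^+ 2 / 2).
Proof.
have mc : measurable_fun [set: R] (fun x => cos (t * x + b)).
  apply: continuous_measurable_fun => x; apply: continuous_comp; last exact: continuous_cos.
  by apply: cvgD; [apply: cvgM; [exact: cvg_cst|exact: cvg_id]|exact: cvg_cst].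
have [s0|s0] := eqVneq s 0.
  rewrite (law_Rintegral mY (law0 s0) mc) dirac_int//.
  by rewrite s0 mulr0 expr0n oppr0 mul0r expR0 mulr1.
have {}s0 : 0 < s by rewrite lt0r s0.
rewrite (law_Rintegral mY (law1 s0) mc) -(normal_prob_cos m s0).
by apply: eq_Rintegral => x _; congr cos; ring.
Qed.

Lemma normal_law_centered_mean : \int[P]_w (Y w - m) = 0.
Proof.
have mc : measurable_fun [set: R] (fun x => x - m) by exact: measurable_funB.
have [s0|s0] := eqVneq s 0.
  by rewrite (law_Rintegral mY (law0 s0) mc) dirac_int// subrr.
have {}s0 : 0 < s by rewrite lt0r s0.
by rewrite (law_Rintegral mY (law1 s0) mc) normal_prob_centered_mean.
Qed.

Lemma normal_law_centered_second_moment :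
  \int[P]_w ((Y w - m) ^+ 2) = s ^+ 2.
Proof.
have mc : measurable_fun [set: R] (fun x => (x - m) ^+ 2).
  by apply: measurable_funX; exact: measurable_funB.
have [s0|s0] := eqVneq s 0.
  by rewrite (law_Rintegral mY (law0 s0) mc) dirac_int// subrr s0.
have {}s0 : 0 < s by rewrite lt0r s0.
by rewrite (law_Rintegral mY (law1 s0) mc) normal_prob_centered_second_moment.
Qed.

End normal_law.

(** * Trigonometric approximation of the indicator of a half-line *)

Section soft_step.
Variable R : realType.
Implicit Types (x y t : R) (n : nat).

(* Bernstein's trick: with s = sin (x / n) and N = n ^ 2, the value
   (1 - ((1 + s) / 2) ^ N) ^ (2 ^ N) is close to exp (- (1 + s) ^ N). *)
Definition soft_step n : {poly R} :=
  (1 - (2^-1 *: (1 + 'X)) ^+ (n.+1 ^ 2)) ^+ (2 ^ (n.+1 ^ 2)).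

Lemma horner_soft_step n x :
  (soft_step n).[x] = (1 - ((1 + x) / 2) ^+ (n.+1 ^ 2)) ^+ (2 ^ (n.+1 ^ 2)).
Proof. by rewrite /soft_step !hornerE mulrC. Qed.

Let base_itv n x : `|x| <= 1 -> 0 <= ((1 + x) / 2) ^+ n <= 1.
Proof.
by move=> /ler_normlP[x1 x2]; rewrite exprn_ge0 ?exprn_ile1//; lra.
Qed.

Lemma soft_step_itv n x : `|x| <= 1 -> 0 <= (soft_step n).[x] <= 1.
Proof.
move=> /(base_itv (n.+1 ^ 2)) /andP[h1 h2].
by rewrite horner_soft_step exprn_ge0 ?exprn_ile1//; lra.
Qed.

Lemma bernoulli_ineq n y : -1 <= y -> 1 + n%:R * y <= (1 + y) ^+ n.
Proof.
move=> y1; elim: n => [|n IH]; first by rewrite mul0r addr0 expr0.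
rewrite exprSr; apply: le_trans (ler_wpM2r _ IH); last by lra.
rewrite -natr1; have := sqr_ge0 y; have : 0 <= n%:R :> R by [].
by nra.
Qed.

(** By Bernoulli 1 + n y <= (1 + y)^n, and (1 - y)^n (1 + y)^n = (1 - y^2)^n <= 1. *)
Lemma expr_onem_le n y : 0 <= y <= 1 -> (1 - y) ^+ n <= (1 + n%:R * y)^-1.
Proof.
move=> /andP[y0 y1].
have h : 0 < 1 + n%:R * y by rewrite ltr_wpDr// mulr_ge0.
rewrite -[leRHS]mul1r ler_pdivlMr//.
apply: le_trans (ler_wpM2l _ (@bernoulli_ineq n y _)) _; first by rewrite exprn_ge0; lra.
  by lra.
by rewrite -exprMn exprn_ile1//; nra.
Qed.

Let scaleE N x : (2 ^ N)%:R * ((1 + x) / 2) ^+ N = (1 + x) ^+ N.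
Proof. by rewrite natrX -exprMn mulrCA divff ?mulr1. Qed.

(** The outer exponent 2^N cancels the halves of the base, so [expr_onem_le] gives the bound 1 / (1
    + (1 + x)^N); Bernoulli then bounds (1 + x)^N below by 1 + N x. *)
Lemma soft_step_le n x : 0 <= x <= 1 ->
  (soft_step n).[x] <= (1 + n.+1%:R ^+ 2 * x)^-1.
Proof.
move=> /andP[x0 x1]; rewrite horner_soft_step.
apply: le_trans (expr_onem_le _ _) _; first by apply: base_itv; rewrite ger0_norm.
have h : 0 <= n.+1%:R ^+ 2 * x by rewrite mulr_ge0.
rewrite lef_pV2 ?posrE ?scaleE; last 2 first.
- by rewrite ltr_wpDr// exprn_ge0//; lra.
- by lra.
rewrite -natrX (le_trans (@bernoulli_ineq (n.+1 ^ 2) x _)) ?lerDr//; lra.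
Qed.

(** Here Bernoulli comes first and gives 1 - (1 - x)^N, and [expr_onem_le] then bounds (1 - x)^N. *)
Lemma soft_step_ge n x : 0 <= x <= 1 ->
  1 - (1 + n.+1%:R ^+ 2 * x)^-1 <= (soft_step n).[- x].
Proof.
move=> /andP[x0 x1]; rewrite horner_soft_step.
have /andP[b0 b1] := @base_itv (n.+1 ^ 2) (- x) ltac:(by rewrite normrN ger0_norm).
apply: le_trans (@bernoulli_ineq _ _ _); last by lra.
rewrite mulrN scaleE lerD2l lerN2 -natrX.
by apply: expr_onem_le; rewrite x0.
Qed.

(** The difference quotient of the sine at 0 tends to 1, hence is eventually at least 1/2. *)
Lemma near_sin_ge_half x : 0 < x ->
  \forall n \near \oo, x / n.+1%:R / 2 <= sin (x / n.+1%:R) <= 1.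
Proof.
move=> x0.
have h0 : x / n.+1%:R @[n --> \oo] --> (0 : R).
  by rewrite -(mulr0 x); apply: cvgM; [exact: cvg_cst|exact: cvg_harmonic].
have := @is_derive_sin R 0 => -[ds es].
have /cvgr_dnbhsP/(_ (fun n => x / n.+1%:R)) : h^-1 *: (sin (h *: 1 + 0) - sin 0) @[h --> 0^'] --> (1 : R).
  have : h^-1 *: (sin (h *: 1 + 0) - sin 0) @[h --> 0^'] --> 'D_1 (@sin R) 0 by exact: ds.
  by rewrite es cos0.
have n0 n : x / n.+1%:R != 0 by rewrite mulf_neq0 ?gt_eqF// invr_gt0.
move=> /(_ (conj n0 h0)) /cvgrPdist_le /(_ 2^-1 ltac:(lra)) H.
near=> n.
have : `|1 - (x / n.+1%:R)^-1 *: (sin ((x / n.+1%:R) *: 1 + 0) - sin 0)| <= 2^-1 :> R.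
  by near: n.
rewrite /GRing.scale/= mulr1 addr0 sin0 subr0.
set y := x / _; have y0 : 0 < y by rewrite divr_gt0.
move=> /ler_normlP[_ h].
rewrite sin_le1 andbT -[leRHS](mulVKf (lt0r_neq0 y0)) ler_pM2l//; lra.
Unshelve. all: by end_near. Qed.

(** This is why the exponent is a square: the sine is only of order x / (n + 1), and the factor (n +
    1)^2 still drives the product to infinity. *)
Lemma cvg_sqr_sin x : 0 < x ->
  (1 + n.+1%:R ^+ 2 * sin (x / n.+1%:R))^-1 @[n --> \oo] --> (0 : R).
Proof.
move=> x0.
have h1 : 2 / x * n.+1%:R^-1 @[n --> \oo] --> (0 : R).
  by rewrite -(mulr0 (2 / x)); apply: cvgM; [exact: cvg_cst|exact: cvg_harmonic].
apply: (squeeze_cvgr _ (cvg_cst 0) h1); near=> n.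
have /andP[h _] : x / n.+1%:R / 2 <= sin (x / n.+1%:R) <= 1.
  by near: n; exact: near_sin_ge_half.
have N0 : 0 < n.+1%:R :> R by [].
have k : n.+1%:R * x / 2 <= 1 + n.+1%:R ^+ 2 * sin (x / n.+1%:R).
  apply: (@le_trans _ _ (n.+1%:R ^+ 2 * (x / n.+1%:R / 2))).
    by rewrite le_eqVlt; apply/orP; left; apply/eqP; field; rewrite gt_eqF.
  by rewrite ler_wpDl// ler_wpM2l.
have p0 : 0 < n.+1%:R * x / 2 by rewrite divr_gt0 ?mulr_gt0.
rewrite invr_ge0 (le_trans (ltW p0) k)/=.
rewrite (_ : 2 / x / n.+1%:R = (n.+1%:R * x / 2)^-1).
  by rewrite lef_pV2 ?posrE// (lt_le_trans p0).
by field; rewrite !gt_eqF.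
Unshelve. all: by end_near. Qed.

Lemma soft_step_cvg0 x : 0 < x ->
  (soft_step n).[sin (x / n.+1%:R)] @[n --> \oo] --> (0 : R).
Proof.
move=> x0; apply: (squeeze_cvgr _ (cvg_cst 0) (cvg_sqr_sin x0)); near=> n.
have /andP[h1 h2] : x / n.+1%:R / 2 <= sin (x / n.+1%:R) <= 1.
  by near: n; exact: near_sin_ge_half.
have s0 : 0 <= sin (x / n.+1%:R) by apply: le_trans h1; rewrite !divr_ge0// ltW.
have /andP[-> _]/= := @soft_step_itv n (sin (x / n.+1%:R)) ltac:(by rewrite ger0_norm).
by apply: soft_step_le; rewrite s0.
Unshelve. all: by end_near. Qed.

Lemma soft_step_cvg1 x : x < 0 ->
  (soft_step n).[sin (x / n.+1%:R)] @[n --> \oo] --> (1 : R).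
Proof.
rewrite -oppr_gt0 => x0.
have c1 : 1 - (1 + n.+1%:R ^+ 2 * sin (- x / n.+1%:R))^-1 @[n --> \oo] --> (1 : R).
  by rewrite -[X in _ --> X]subr0; apply: cvgB; [exact: cvg_cst|exact: cvg_sqr_sin].
apply: (squeeze_cvgr _ c1); last exact: cvg_cst.
near=> n.
have /andP[h1 h2] : - x / n.+1%:R / 2 <= sin (- x / n.+1%:R) <= 1.
  by near: n; exact: near_sin_ge_half.
have s0 : 0 <= sin (- x / n.+1%:R) by apply: le_trans h1; rewrite !divr_ge0// ltW.
rewrite (_ : sin (x / n.+1%:R) = - sin (- x / n.+1%:R)); last first.
  by rewrite mulNr sinN opprK.
have /andP[_ ->]/= := @soft_step_itv n (- sin (- x / n.+1%:R))
  ltac:(by rewrite normrN ger0_norm).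
by rewrite andbT; apply: soft_step_ge; rewrite s0.
Unshelve. all: by end_near. Qed.

End soft_step.

(** * From orthogonality to cosines to orthogonality to half-line indicators *)

Section bounded_random_variables.
Context d (T : measurableType d) (R : realType) (P : probability T R).
Implicit Types (f g D Y : T -> R).

Lemma bounded_integrable f (C : R) : measurable_fun setT f ->
  (forall w, `|f w| <= C) -> P.-integrable setT (fun w => (f w)%:E).
Proof.
move=> mf fC; apply: (@le_integrable _ _ _ P setT measurableT _ (EFin \o cst C)).
- exact/measurable_EFinP.
- by move=> w _; rewrite /= lee_fin (le_trans (fC w))// ler_norm.
- exact: finite_measure_integrable_cst.
Qed.

Lemma measurable_fun_cos f : measurable_fun setT f ->
  measurable_fun setT (fun w => cos (f w)).
Proof.
move=> mf; apply: (measurableT_comp _ mf).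
by apply: continuous_measurable_fun; exact: continuous_cos.
Qed.

Lemma cos_prod (x y : R) : cos x * cos y = (cos (x + y) + cos (x - y)) / 2.
Proof. by rewrite cosD cosB; field. Qed.

Section annihilates_cos.
Variables (D Y : T -> R) (C : R).
Hypotheses (mD : measurable_fun setT D) (mY : measurable_fun setT Y)
  (DC : forall w, `|D w| <= C)
  (Dcos : forall a b, \int[P]_w (D w * cos (a * Y w + b)) = 0).

Let lin a b w : R := a * Y w + b.

Let mlin a b : measurable_fun setT (lin a b).
Proof. by apply: measurable_funD => //; exact: measurable_funM. Qed.


Let norm1 w (y : R) : `|y| <= 1 -> `|D w * y| <= C.
Proof. by move=> h; rewrite normrM -[C]mulr1 ler_pM. Qed.

(** The extra factor cos (a Y + b) stays arbitrary so that the induction can absorb one more cosine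
    into it by the product formula. *)
Lemma annihilates_cosX u v n a b :
  \int[P]_w (D w * (cos (lin u v w) ^+ n * cos (lin a b w))) = 0.
Proof.
elim: n a b => [|n IH] a b.
  by under eq_Rintegral do rewrite expr0 mul1r; exact: Dcos.
have b1 a' b' w : `|cos (lin u v w) ^+ n * cos (lin a' b' w)| <= 1.
  by rewrite normrM mulr_ile1 ?normrX ?exprn_ile1 ?cos_max.
have m1 a' b' : measurable_fun setT
    (fun w => D w * (cos (lin u v w) ^+ n * cos (lin a' b' w))).
  apply: measurable_funM => //; apply: measurable_funM; last exact: measurable_fun_cos.
  by apply: measurable_funX; exact: measurable_fun_cos.
have i1 a' b' : P.-integrable setT
    (fun w => (D w * (cos (lin u v w) ^+ n * cos (lin a' b' w)))%:E).
  by apply: (bounded_integrable (C := C)) => // w; exact: norm1 (b1 _ _ _).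
transitivity (\int[P]_w (2^-1 * (D w * (cos (lin u v w) ^+ n * cos (lin (u + a) (v + b) w)) +
   D w * (cos (lin u v w) ^+ n * cos (lin (u - a) (v - b) w))))).
  apply: eq_Rintegral => w _; rewrite exprSr -!mulrA [cos _ * cos _]cos_prod.
  rewrite (_ : lin (u + a) (v + b) w = lin u v w + lin a b w); last by rewrite /lin; ring.
  rewrite (_ : lin (u - a) (v - b) w = lin u v w - lin a b w); last by rewrite /lin; ring.
  by field.
have i2 := integrableD measurableT (i1 (u + a) (v + b)) (i1 (u - a) (v - b)).
rewrite RintegralZl//.
rewrite RintegralD; [|by []|exact: i1|exact: i1].
by rewrite !IH addr0 mulr0.
Qed.

Lemma annihilates_poly_cos (p : {poly R}) u v :
  \int[P]_w (D w * p.[cos (lin u v w)]) = 0.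
Proof.
have mc : measurable_fun setT (fun w => cos (lin u v w)) by exact: measurable_fun_cos.
have bX n w : `|cos (lin u v w) ^+ n| <= 1 by rewrite normrX exprn_ile1 ?cos_max.
have iX n : P.-integrable setT (fun w => (D w * cos (lin u v w) ^+ n)%:E).
  apply: (bounded_integrable (C := C)) => [|w]; last exact: norm1 (bX _ _).
  by apply: measurable_funM => //; exact: measurable_funX.
have iXc n : P.-integrable setT (EFin \o (fun w => (p`_n * (D w * cos (lin u v w) ^+ n)))).
  by rewrite /comp; under eq_fun do rewrite EFinM; exact: integrableZl.
have X0 n : \int[P]_w (D w * cos (lin u v w) ^+ n) = 0.
  rewrite -[RHS](annihilates_cosX u v n 0 0); apply: eq_Rintegral => w _.
  by rewrite /lin mul0r addr0 cos0 mulr1.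
transitivity (\int[P]_w (\sum_(i < size p) p`_i * (D w * cos (lin u v w) ^+ i))).
  apply: eq_Rintegral => w _; rewrite horner_coef mulr_sumr.
  by apply: eq_bigr => i _; ring.
(* Integrability is carried along because additivity of the integral asks for it at each step. *)
suff H m : P.-integrable setT (EFin \o (fun w => (\sum_(i < m) p`_i * (D w * cos (lin u v w) ^+ i)))) /\
    \int[P]_w (\sum_(i < m) p`_i * (D w * cos (lin u v w) ^+ i)) = 0.
  exact: (H _).2.
elim: m => [|m [IH1 IH2]].
  under eq_Rintegral do rewrite big_ord0; rewrite /comp.
  under eq_fun do rewrite big_ord0; split; first exact: integrable0.
  by rewrite Rintegral_cst// mul0r.
rewrite /comp; under eq_fun do rewrite big_ord_recr/= EFinD.
under eq_Rintegral do rewrite big_ord_recr/=.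
split; first exact: (integrableD _ IH1 (iXc m)).
rewrite RintegralD; [|by []|exact: IH1|exact: iXc].
rewrite IH2 add0r RintegralZl; [|by []|exact: iX].
by rewrite X0 mulr0.
Qed.

Lemma annihilates_halfline t : P (Y @^-1` [set t]) = 0%E ->
  \int[P]_w (D w * (Y w <= t)%R%:R) = 0.
Proof.
move=> Pt.
pose g n w := D w * (soft_step R n).[sin ((Y w - t) / n.+1%:R)].
(* The phase - pi / 2 rewrites the sine as a cosine of an affine function of Y. *)
have gE n w : g n w = D w * (soft_step R n).[cos (lin n.+1%:R^-1 (- t / n.+1%:R - pi / 2) w)].
  rewrite /g /lin; congr (_ * _.[_]); rewrite addrA cosBpihalf; congr sin; ring.
have g0 n : \int[P]_w g n w = 0.
  by under eq_Rintegral do rewrite gE; exact: annihilates_poly_cos.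
have mg n : measurable_fun setT (g n).
  apply: measurable_funM => //; apply: (measurableT_comp (f := fun x => (soft_step R n).[x])).
    by apply: continuous_measurable_fun; exact: continuous_horner.
  apply: (measurableT_comp (f := fun x => sin x)).
    by apply: continuous_measurable_fun; exact: continuous_sin.
  by apply: measurable_funM => //; exact: measurable_funB.
have bg n w : `|g n w| <= C.
  rewrite /g; apply: norm1.
  by have /andP[h1 h2] := soft_step_itv n (sin_max ((Y w - t) / n.+1%:R)); rewrite ger0_norm.
have mh : measurable_fun setT (fun w => D w * (Y w <= t)%R%:R).
  apply: measurable_funM => //.
  rewrite (_ : (fun w => (Y w <= t)%R%:R) = \1_(Y @^-1` [set` `]-oo, t]])).
    by apply: measurable_indic; rewrite -[X in measurable X]setTI; exact: mY.
  by apply/funext => w; rewrite indicE/=; congr ((nat_of_bool _)%:R); apply/idP/idP; rewrite inE/= in_itv/=.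
have [||||| _ _ lim1] := @dominated_convergence _ _ _ P setT measurableT
  (fun n w => (g n w)%:E) (fun w => (D w * (Y w <= t)%R%:R)%:E) (EFin \o cst C).
- by move=> n; exact/measurable_EFinP.
- exact/measurable_EFinP.
(* Pointwise convergence is known off the end point t only; the missing atom at t makes the
   exceptional set null. *)
- exists (Y @^-1` [set t]); split => //.
    by rewrite -[X in measurable X]setTI; exact: mY.
  move=> w /= h; apply/eqP; apply: contrapT => /eqP Yt; apply: h => _.
  apply/cvg_EFin; first exact: nearW.
  rewrite /comp/=; apply: cvgM; first exact: cvg_cst.
  have [Ylt|Ygt|Yeq] := ltgtP (Y w) t; last by rewrite Yeq eqxx in Yt.
    by apply: soft_step_cvg1; rewrite subr_lt0.
  by apply: soft_step_cvg0; rewrite subr_gt0.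
- exact: finite_measure_integrable_cst.
- by apply: aeW => w n _; rewrite lee_fin.
have lim0 : (\int[P]_w (g n w)%:E)%E @[n --> \oo] --> 0%E.
  rewrite (_ : (fun n => _) = cst 0%E); first exact: cvg_cst.
  apply/funext => n /=; rewrite -[LHS]fineK; last first.
    by apply: integrable_fin_num => //; exact: (bounded_integrable (C := C)).
  by rewrite -[RHS](congr1 EFin (g0 n)).
by rewrite /Rintegral (cvg_unique _ lim1 lim0).
Qed.

End annihilates_cos.

End bounded_random_variables.

(** * Independence from a factorized characteristic function *)

Section uncorrelated_normal_independent.
Context d (T : measurableType d) (R : realType) (P : probability T R).
Variables (J : finType) (W : J -> T -> R) (s t : J -> R).
Hypothesis mW : forall i, measurable_fun setT (W i).
Hypothesis W_neq : forall i, P (W i @^-1` [set t i]) = 0%E.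

Let S (a : J -> R) w := \sum_i a i * W i w.
Let e i (c : R) := expR (- (c * s i) ^+ 2 / 2).

Hypothesis WS_cos : forall (a : J -> R) b,
  \int[P]_w cos (\sum_i a i * W i w + b) =
  cos b * \prod_i expR (- (a i * s i) ^+ 2 / 2).

Let G (r : seq J) w : R := \prod_(i <- r) (W i w <= t i)%R%:R.
Let p i := fine (P [set w | W i w <= t i]).

Let mset i : measurable [set w | W i w <= t i].
Proof.
rewrite (_ : [set w | _] = W i @^-1` [set` `]-oo, t i]]).
  by rewrite -[X in measurable X]setTI; exact: mW.
by apply/seteqP; split => w /=; rewrite in_itv.
Qed.

Let indE i w : (W i w <= t i)%R%:R = \1_[set w | W i w <= t i] w :> R.
Proof. by rewrite indicE; congr ((nat_of_bool _)%:R); apply/idP/idP; rewrite inE. Qed.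

Let mS a : measurable_fun setT (S a).
Proof. by apply: measurable_sum => i; exact: measurable_funM. Qed.

Let mG r : measurable_fun setT (G r).
Proof.
apply: measurable_prod => i _.
under eq_fun do rewrite indE; exact: measurable_indic.
Qed.

Let G_norm r w : `|G r w| <= 1.
Proof.
have h i : 0 <= ((W i w <= t i)%R%:R : R) <= 1 by rewrite ler0n lern1 leq_b1.
rewrite ger0_norm; first by apply: prodr_ile1 => i _; exact: h.
by apply: prodr_ge0 => i _; have /andP[] := h i.
Qed.

Let upd (a : J -> R) j c i : R := a i + (if i == j then c else 0).

Let S_upd a j c w : S (upd a j c) w = S a w + c * W j w.
Proof.
rewrite /S /upd; under eq_bigr do rewrite mulrDl; rewrite big_split/=; congr (_ + _).
rewrite (bigD1 j)//= eqxx big1 ?addr0// => i /negbTE ->.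
by rewrite mul0r.
Qed.

Let e_upd a j c : a j = 0 -> \prod_i e i (upd a j c i) = e j c * \prod_i e i (a i).
Proof.
move=> aj; rewrite [LHS](bigD1 j)//= [X in _ = _ * X](bigD1 j)//=.
rewrite /upd eqxx aj add0r [e j 0]/e mul0r expr0n/= oppr0 mul0r expR0 mul1r.
by congr (_ * _); apply: eq_bigr => i /negbTE ->; rewrite addr0.
Qed.

Let e_opp j c : e j (- c) = e j c.
Proof. by rewrite /e; congr expR; ring. Qed.

Let integral_ind i : \int[P]_w (W i w <= t i)%R%:R = p i.
Proof.
under eq_Rintegral do rewrite indE.
by rewrite /Rintegral integral_indic// setIT.
Qed.

(** Cosines are traded for half-line indicators one index at a time. An index in [r] carries its
    indicator and has frequency 0; the others still contribute through the cosine. *)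
Let key (r : seq J) : uniq r -> forall a b, (forall i, i \in r -> a i = 0) ->
  \int[P]_w (G r w * cos (S a w + b)) =
  \prod_(i <- r) p i * (cos b * \prod_i e i (a i)).
Proof.
elim: r => [_ a b _|j r IH /= /andP[jr ur] a b ar].
  under eq_Rintegral do rewrite /G big_nil mul1r.
  by rewrite big_nil mul1r /S WS_cos.
have aj : a j = 0 by rewrite ar ?mem_head.
have ar' i : i \in r -> a i = 0 by move=> ir; rewrite ar// inE ir orbT.
have urj c i : i \in r -> upd a j c i = 0.
  move=> ir; rewrite /upd ar'// ifF ?addr0//.
  by apply/negP => /eqP ij; rewrite -ij ir in jr.
set pr := \prod_(i <- r) p i; set k := cos b * \prod_i e i (a i).
(* The integrand for the shorter list, centred. Once [D] is orthogonal to every cos (c W_j + b'), it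
   is orthogonal to the indicator of W_j <= t_j, which is the claim for j :: r. *)
pose D w := G r w * cos (S a w + b) - pr * k.
have mGc r' a' b' : measurable_fun setT (fun w => G r' w * cos (S a' w + b')).
  apply: measurable_funM; first exact: mG.
  by apply: measurable_fun_cos; apply: measurable_funD => //; exact: mS.
have bGc r' a' b' w : `|G r' w * cos (S a' w + b')| <= 1.
  by rewrite normrM mulr_ile1 ?cos_max ?G_norm.
have iGc r' a' b' := bounded_integrable P (mGc r' a' b') (bGc r' a' b').
have mD : measurable_fun setT D by exact: measurable_funB.
have DC w : `|D w| <= 1 + `|pr * k|.
  by apply: le_trans (ler_normB _ _) _; rewrite lerD2r bGc.
have mcW c b' : measurable_fun setT (fun w => cos (c * W j w + b')).
  by apply: measurable_fun_cos; apply: measurable_funD => //; exact: measurable_funM.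
have icW c b' : P.-integrable setT (fun w => (cos (c * W j w + b'))%:E).
  by apply: (bounded_integrable P (C := 1)) => // w; exact: cos_max.
have IcW c b' : \int[P]_w cos (c * W j w + b') = cos b' * e j c.
  have := WS_cos (upd (fun=> 0) j c) b'.
  rewrite (_ : \prod_i _ = \prod_i e i (upd (fun=> 0) j c i))//.
  rewrite e_upd// [X in _ * (_ * X)]big1 ?mulr1; last first.
    by move=> i _; rewrite /e mul0r expr0n/= oppr0 mul0r expR0.
  move=> <-; apply: eq_Rintegral => w _; rewrite -/(S _ w) S_upd.
  by rewrite /S big1 ?add0r// => i _; rewrite mul0r.
have Dcos c b' : \int[P]_w (D w * cos (c * W j w + b')) = 0.
  (* The product formula gives j the frequencies c and - c. The induction hypothesis applies to both
     since j is not in [r]; [e j] is even, and the two phases recombine into cos b * cos b'. *)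
  transitivity (\int[P]_w (2^-1 * (G r w * cos (S (upd a j c) w + (b + b')) +
      G r w * cos (S (upd a j (- c)) w + (b - b'))) - pr * k * cos (c * W j w + b'))).
    apply: eq_Rintegral => w _; rewrite /D mulrBl; congr (_ - _).
    rewrite -mulrA cos_prod !S_upd.
    rewrite (_ : S a w + c * W j w + (b + b') = S a w + b + (c * W j w + b')); last by ring.
    rewrite (_ : S a w + - c * W j w + (b - b') = S a w + b - (c * W j w + b')); last by ring.
    by field.
  have i1 := iGc r (upd a j c) (b + b'); have i2 := iGc r (upd a j (- c)) (b - b').
  have i12 := integrableD measurableT i1 i2.
  rewrite RintegralB; [|by []| |]; last 2 first.
  - by rewrite /comp; under eq_fun do rewrite EFinM; exact: integrableZl.
  - by rewrite /comp; under eq_fun do rewrite EFinM; exact: integrableZl.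
  rewrite RintegralZl//.
  rewrite RintegralD; [|by []|exact: i1|exact: i2].
  rewrite RintegralZl; [|by []|exact: icW].
  rewrite IcW (IH ur _ _ (urj c)) (IH ur _ _ (urj (- c))).
  rewrite (@e_upd a j c aj) (@e_upd a j (- c) aj) e_opp cosD cosB /k -/pr.
  move: (\prod_i _) (e j c) => E F; by field.
have := annihilates_halfline mD (mW j) DC Dcos (W_neq j).
rewrite /D; under eq_Rintegral do rewrite mulrBl.
have mI : measurable_fun setT (fun w => (W j w <= t j)%R%:R : R).
  by under eq_fun do rewrite indE; exact: measurable_indic.
have bI w : `|(W j w <= t j)%R%:R : R| <= 1.
  by rewrite ger0_norm ?ler0n// lern1 leq_b1.
have iI := bounded_integrable P mI bI.
rewrite RintegralB; [|by []| |]; last 2 first.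
- apply: (bounded_integrable P (C := 1)); first exact: measurable_funM.
  by move=> w; rewrite normrM mulr_ile1.
- by rewrite /comp; under eq_fun do rewrite EFinM; exact: integrableZl.
rewrite RintegralZl; [|by []|exact: iI].
rewrite integral_ind => /eqP; rewrite subr_eq0 => /eqP h.
rewrite big_cons -/pr (mulrC (p j)) mulrAC -h.
by apply: eq_Rintegral => w _; rewrite /G big_cons; ring.
Qed.

Lemma prob_le_prod :
  P [set w | forall i, W i w <= t i] = (\prod_i fine (P [set w | (W i w <= t i)%R]))%:E.
Proof.
have := @key (index_enum J) (index_enum_uniq J) (fun=> 0) 0 (fun _ _ => erefl).
rewrite cos0 mul1r [X in _ * X]big1 ?mulr1; last first.
  by move=> i _; rewrite /e mul0r expr0n/= oppr0 mul0r expR0.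
move=> <-.
have mA : measurable [set w | forall i, W i w <= t i].
  rewrite (_ : [set w | _] = \bigcap_(i in [set: J]) [set w | W i w <= t i]).
    apply: fin_bigcap_measurable => //; exact: finite_finset.
  by apply/seteqP; split => w /= h i; [move=> _|]; exact: h.
transitivity ((\int[P]_w \1_[set w | forall i, W i w <= t i] w)%:E).
  rewrite /Rintegral fineK; last first.
    by rewrite integral_indic// setIT fin_num_measure.
  by rewrite integral_indic// setIT.
congr EFin; apply: eq_Rintegral => w _.
rewrite /S big1 ?addr0 ?cos0 ?mulr1; last by move=> i _; rewrite mul0r.
rewrite /G indicE; case: (boolP (_ \in _)); rewrite ?inE/= => h.
  by rewrite big1// => i _; rewrite h.
have /existsNP[i /negP hi] : ~ forall i, W i w <= t i by move=> H; move/negP: h; apply; rewrite inE.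
by rewrite (bigD1 i)//= (negbTE hi) mul0r.
Qed.

End uncorrelated_normal_independent.

(** * The standard normal distribution function and its tail *)

Section Phi_theory.
Variable R : realType.
Local Notation mu := (@lebesgue_measure R).
Local Notation N := (normal_prob (0 : R) 1).
Local Notation p := (normal_pdf (0 : R) 1).
Implicit Types (x y : R).

Lemma Phi_EFin x : N `]-oo, x] = (Phi x)%:E.
Proof. by rewrite /Phi fineK// fin_num_measure. Qed.

Lemma Phi_ge0 x : 0 <= Phi x. Proof. exact: fine_ge0. Qed.

Lemma normal_prob_set1 x : N [set x] = 0%E.
Proof. by rewrite /normal_prob integral_set1. Qed.

Lemma Phi_diff x y : x <= y -> N `]x, y] = (Phi y - Phi x)%:E.
Proof.
move=> xy; rewrite EFinB -!Phi_EFin.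
rewrite (@itv_bndbnd_setU _ _ -oo%O (BRight x) (BRight y))//=.
rewrite measureU//=; last first.
  by apply/seteqP; split => z //= [/=]; rewrite !in_itv/= => h1 /andP[]; rewrite ltNge h1.
by rewrite [X in _ = (_ - X)%E]Phi_EFin addeAC Phi_EFin subee ?add0e.
Qed.

(** A positive lower bound on the density yields strict monotonicity, and its peak as upper bound
    yields Lipschitz continuity. *)
Lemma Phi_increment_bounds x y (l u : R) : x <= y ->
  (forall z, x < z <= y -> l <= p z <= u) ->
  l * (y - x) <= Phi y - Phi x <= u * (y - x).
Proof.
move=> xy lu; rewrite -!lee_fin -Phi_diff// /normal_prob.
have mz : mu `]x, y] = (y - x)%:E.
  by rewrite lebesgue_measure_itv/= lte_fin; case: ltgtP xy => // ->; rewrite subrr.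
rewrite !EFinM -mz -!integral_cst//.
have mp : measurable_fun `]x, y] (fun z => (p z)%:E).
  by apply/measurable_funTS/measurable_EFinP; exact: measurable_normal_pdf.
have ip : mu.-integrable `]x, y] (fun z => (p z)%:E).
  exact: integrableS (integrable_normal_pdf 0 1).
have ic (c : R) : mu.-integrable `]x, y] (cst c%:E).
  apply/integrableP; split => //; rewrite integral_cst//= mz.
  by rewrite -EFinM ltry.
apply/andP; split; apply: le_integral => //.
- by move=> z; rewrite inE/= in_itv/= => /lu /andP[].
- by move=> z; rewrite inE/= in_itv/= => /lu /andP[].
Qed.

Lemma Phi_lt x y : x < y -> Phi x < Phi y.
Proof.
(* Every point between x and y has absolute value at most [M], so the density is at least its value
   at [M] there. *)
move=> xy; pose M := Num.max `|x| `|y|.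
have pk : 0 < normal_peak (1 : R) by rewrite normal_peak_gt0 ?oner_neq0.
have lu z : x < z <= y -> normal_peak 1 * expR (- M ^+ 2 / 2) <= p z <= normal_peak 1.
  move=> /andP[xz zy].
  rewrite normal_pdf_ub ?oner_neq0// andbT normal_pdfE ?oner_neq0//.
  rewrite ler_pM2l// /normal_fun ler_expR subr0 expr1n.
  rewrite ler_pM2r ?invr_gt0// lerN2 -(real_normK (num_real z)).
  rewrite lerXn2r ?nnegrE//; first by rewrite /M le_max normr_ge0.
  rewrite /M le_max; have [z0|z0] := leP 0 z.
    by rewrite (ger0_norm z0) (le_trans zy (ler_norm _)) orbT.
  by rewrite (ltr0_norm z0) (@le_trans _ _ (- x)) ?lerN2 ?(ltW xz)// -normrN ler_norm.
have /andP[h _] := Phi_increment_bounds (ltW xy) lu.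
rewrite -subr_gt0 (lt_le_trans _ h)// mulr_gt0 ?subr_gt0//.
by rewrite mulr_gt0// expR_gt0.
Qed.

Lemma Phi_le : {mono (@Phi R) : x y / x <= y}.
Proof. by apply: le_mono => x y; exact: Phi_lt. Qed.

Lemma continuous_Phi : continuous (@Phi R).
Proof.
have lip x y : x <= y -> `|Phi x - Phi y| <= normal_peak 1 * `|x - y|.
  move=> xy; rewrite distrC (distrC x) !ger0_norm ?subr_ge0 ?Phi_le//.
  have lu z : x < z <= y -> 0 <= p z <= normal_peak 1.
    by move=> _; rewrite normal_pdf_ge0 normal_pdf_ub ?oner_neq0.
  by have /andP[] := Phi_increment_bounds xy lu.
have {}lip x y : `|Phi x - Phi y| <= normal_peak 1 * `|x - y|.
  have [|/ltW] := leP x y; first exact: lip.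
  by move=> yx; rewrite distrC (distrC x); exact: lip.
move=> x; apply/cvgrPdist_le => e e0.
have pk : 0 < normal_peak (1 : R) by rewrite normal_peak_gt0 ?oner_neq0.
near=> y; apply: le_trans (lip _ _) _.
rewrite -ler_pdivlMl//; near: y.
have /cvgrPdist_le := @cvg_id _ (nbhs x).
by apply; rewrite mulr_gt0// invr_gt0.
Unshelve. all: by end_near. Qed.

Let mid : measurable_fun [set: measurableTypeR R] (fun x : measurableTypeR R => (x : R)).
Proof. exact: measurable_id. Qed.

(** The identity, as a random variable under the standard normal law, has [Phi] as its cdf, which
    gives the limits of [Phi] at both infinities. *)
Let idR : {RV N >-> R} := mfun_Sub (mem_set mid).

Let cdfE : cdf idR = (fun x => (Phi x)%:E).
Proof. by apply/funext => x; rewrite -Phi_EFin. Qed.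

Lemma cvg_Phi_pinfty : Phi x @[x --> +oo] --> (1 : R).
Proof.
have := cvg_cdfy1 idR.
by rewrite cdfE => /fine_cvg.
Qed.

Lemma cvg_Phi_ninfty : Phi x @[x --> -oo] --> (0 : R).
Proof.
have := cvg_cdfNy0 idR.
by rewrite cdfE => /fine_cvg.
Qed.

Lemma Phi_surj (b : R) : 0 < b < 1 -> exists x, Phi x = b.
Proof.
move=> /andP[b0 b1].
have [x xb] : exists x, Phi x < b.
  have /cvgr_lt/(_ _ b0) : Phi x @[x --> -oo] --> (0 : R) := cvg_Phi_ninfty.
  by move=> [M [_ h]]; exists (M - 1); apply: h; lra.
have [y yb] : exists y, b < Phi y.
  have /cvgr_gt/(_ _ b1) : Phi x @[x --> +oo] --> (1 : R) := cvg_Phi_pinfty.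
  by move=> [M [_ h]]; exists (M + 1); apply: h; lra.
have xy : x <= y by rewrite -Phi_le; lra.
have [||z _ zb] := @IVT _ (@Phi R) x y b xy; last by exists z.
- exact/continuous_subspaceT/continuous_Phi.
- by rewrite ge_min le_max (ltW xb) (ltW yb) orbT.
Qed.

Lemma Phi_invK (b : R) : 0 < b < 1 -> Phi (Phi_inv b) = b.
Proof.
move=> /Phi_surj[x xb]; rewrite /Phi_inv.
by apply: (pinvK _); rewrite inE; exists x.
Qed.

Lemma onem_Phi x : (1 - Phi x)%:E = (\int[mu]_(z in `[x, +oo[) (p z)%:E)%E.
Proof.
rewrite EFinB -Phi_EFin -probability_setC// setCitvl.
rewrite -[LHS]/(\int[mu]_(z in `]x, +oo[) (p z)%:E)%E.
rewrite integral_itv_obnd_cbnd//.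
by apply/measurable_funTS/measurable_EFinP; exact: measurable_normal_pdf.
Qed.

Lemma PhiN x : Phi (- x) = 1 - Phi x.
Proof.
apply: EFin_inj; rewrite onem_Phi -Phi_EFin /normal_prob.
rewrite ge0_integration_by_substitutionNy; last 2 first.
- by apply/continuous_subspaceT/continuous_normal_pdf; rewrite oner_neq0.
- by move=> z _; exact: normal_pdf_ge0.
apply: eq_integral => z _; rewrite /= !normal_pdfE ?oner_neq0// /normal_fun.
by rewrite !subr0 sqrrN.
Qed.

(* Translating the density by y multiplies it by at most exp (- y x) on [x, +oo[. *)
Lemma Phi_tail x y : 0 <= y ->
  1 - Phi (x + y) <= expR (- (y * x)) * (1 - Phi x).
Proof.
move=> y0; rewrite -lee_fin EFinM !onem_Phi.
have dF : ((fun z : R => z + y)^`())%classic = cst 1.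
  by apply/funext => z; rewrite derive1E derive_val addr0.
rewrite (@increasing_ge0_integration_by_substitutiony _ (fun z => z + y) p x); last first.
- by move=> z _; exact: normal_pdf_ge0.
- by apply/continuous_subspaceT/continuous_normal_pdf; rewrite oner_neq0.
- by apply: cvg_addrr.
- split; first by move=> z _; exact: ex_derive.
  by apply: cvg_at_right_filter; apply: cvgD; [exact: cvg_id|exact: cvg_cst].
- by rewrite dF; exact: is_cvg_cst.
- by rewrite dF; exact: is_cvg_cst.
- by move=> z _; rewrite dF; exact: cst_continuous.
- by move=> z1 z2 _ _; rewrite ltrD2r.
have mp : measurable_fun [set: R] p by exact: measurable_normal_pdf.
rewrite -ge0_integralZl_EFin ?expR_ge0//; last first.
- by apply/measurable_funTS/measurable_EFinP.
- by move=> z _; rewrite lee_fin normal_pdf_ge0.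
apply: ge0_le_integral => //.
- by move=> z _; rewrite lee_fin dF/= mulr1 normal_pdf_ge0.
- apply/measurable_funTS/measurable_EFinP; rewrite dF.
  apply: measurable_funM => //; apply: (measurableT_comp mp).
  exact: measurable_funD.
- apply/measurable_funTS/measurable_EFinP; exact: measurable_funM.
move=> z; rewrite /= in_itv/= andbT => xz.
rewrite -EFinM lee_fin dF/= mulr1 !normal_pdfE ?oner_neq0// mulrCA.
rewrite ler_pM2l ?normal_peak_gt0 ?oner_neq0// /normal_fun -expRD ler_expR.
by rewrite !subr0 expr1n; nra.
Qed.

End Phi_theory.

(** * Orthonormal combinations of jointly normal variables *)

Section Rintegral_sum.
Context d (T : measurableType d) (R : realType) (mu : {measure set T -> \bar R}).

Lemma Rintegral_sum (I : Type) (r : seq I) (f : I -> T -> R) :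
  (forall i, mu.-integrable setT (fun w => (f i w)%:E)) ->
  mu.-integrable setT (fun w => (\sum_(i <- r) f i w)%:E) /\
  \int[mu]_w (\sum_(i <- r) f i w) = \sum_(i <- r) \int[mu]_w f i w.
Proof.
move=> fi; elim: r => [|i r [IH1 IH2]].
  rewrite big_nil; under eq_Rintegral do rewrite big_nil.
  under eq_fun do rewrite big_nil; split; first exact: integrable0.
  by rewrite /Rintegral integral0.
under eq_fun do rewrite big_cons EFinD.
split; first exact: (integrableD _ (fi i) IH1).
under eq_Rintegral do rewrite big_cons.
rewrite RintegralD; [|by []|exact: fi|exact: IH1].
by rewrite IH2 big_cons.
Qed.

End Rintegral_sum.

Section null_combinations.
Context d (T : measurableType d) (R : realType) (P : probability T R).
Variables (n : nat) (X : 'I_n -> {RV P >-> R}) (A : {set 'I_n}) (r : 'I_n -> 'I_n -> R).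
Hypotheses (gaussX : jointly_gaussian X)
  (lawX : forall i, i \in A -> has_normal_law P (X i) 0 1)
  (r_diag : forall i, i \in A -> r i i = 1)
  (corrX : forall i k, i \in A -> k \in A -> i != k ->
     correlation P (X i) (X k) = r i k).

Let X_integrable i : i \in A -> P.-integrable setT (fun w => (X i w)%:E).
Proof.
move=> iA; apply: (normal_law_integrable (C := 1) _ ler01 (lawX iA) (h := id)) => // x.
by rewrite mul1r subr0 normr_le1Dsqr.
Qed.

Let X_mean i : i \in A -> \int[P]_w X i w = 0.
Proof.
move=> iA; have := normal_law_centered_mean _ ler01 (lawX iA).
by under eq_Rintegral do rewrite subr0; exact.
Qed.

Let X_sqr_integrable i : i \in A -> P.-integrable setT (fun w => (X i w ^+ 2)%:E).
Proof.
move=> iA.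
apply: (normal_law_integrable (C := 1) _ ler01 (lawX iA) (h := fun x => x ^+ 2)) => //.
by move=> x; rewrite mul1r subr0 ger0_norm ?sqr_ge0// lerDr.
Qed.

Let X_sqr i : i \in A -> \int[P]_w (X i w ^+ 2) = 1.
Proof.
move=> iA; have := normal_law_centered_second_moment _ ler01 (lawX iA).
by under eq_Rintegral do rewrite subr0; rewrite expr1n; exact.
Qed.

Let XX_integrable i k : i \in A -> k \in A ->
  P.-integrable setT (fun w => (X i w * X k w)%:E).
Proof.
move=> iA kA; have := integrableD measurableT (X_sqr_integrable iA) (X_sqr_integrable kA).
apply: le_integrable => //.
  by apply/measurable_EFinP; exact: measurable_funM.
move=> w _; rewrite /= lee_fin [leRHS]ger0_norm ?addr_ge0 ?sqr_ge0// normrM.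
rewrite -(real_normK (num_real (X i w))) -(real_normK (num_real (X k w))).
have := sqr_ge0 (`|X i w| - `|X k w|).
have := normr_ge0 (X i w); have := normr_ge0 (X k w); nra.
Qed.

Let covX i k : i \in A -> k \in A ->
  fine (covariance P (X i) (X k)) = \int[P]_w (X i w * X k w).
Proof.
move=> iA kA; rewrite covariance.unlock expectation.unlock.
have E0 l : l \in A -> fine (\int[P]_w (X l w)%:E) = 0 by exact: X_mean.
rewrite (E0 i iA) (E0 k kA) /Rintegral; congr fine; apply: eq_integral => w _.
by rewrite fctE /= !subr0.
Qed.

Let XX_mean i k : i \in A -> k \in A -> \int[P]_w (X i w * X k w) = r i k.
Proof.
move=> iA kA; have [<-|ik] := eqVneq i k.
  by rewrite r_diag// -(X_sqr iA); apply: eq_Rintegral => w _; rewrite expr2.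
have V l : l \in A -> fine 'V_P[X l] = 1.
  by move=> lA; rewrite /variance covX// -(X_sqr lA).
rewrite -(corrX iA kA ik) /correlation !V// sqrtr1 mulr1 divr1.
by rewrite covX.
Qed.

Let S (a : 'I_n -> R) w := \sum_i a i * X i w.
Let supported (a : 'I_n -> R) := forall i, i \notin A -> a i = 0.

Let aX_integrable a i : supported a -> P.-integrable setT (fun w => (a i * X i w)%:E).
Proof.
move=> sa; have [iA|iA] := boolP (i \in A).
  by under eq_fun do rewrite EFinM; apply: integrableZl => //; exact: X_integrable.
by rewrite sa//; under eq_fun do rewrite mul0r; exact: integrable0.
Qed.

Let aXbX_integrable a b i k : supported a -> supported b ->
  P.-integrable setT (fun w => (a i * b k * (X i w * X k w))%:E).
Proof.
move=> sa sb; have [iA|iA] := boolP (i \in A); last first.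
  by rewrite sa//; under eq_fun do rewrite !mul0r; exact: integrable0.
have [kA|kA] := boolP (k \in A); last first.
  by rewrite (sb k)//; under eq_fun do rewrite mulr0 mul0r; exact: integrable0.
by under eq_fun do rewrite EFinM; apply: integrableZl => //; exact: XX_integrable.
Qed.

Let S_mean a : supported a -> \int[P]_w S a w = 0.
Proof.
move=> sa; rewrite (Rintegral_sum _ (fun i => aX_integrable i sa)).2.
rewrite big1// => i _; have [iA|iA] := boolP (i \in A).
  by rewrite RintegralZl ?X_mean ?mulr0//; exact: X_integrable.
by rewrite sa//; under eq_Rintegral do rewrite mul0r; rewrite /Rintegral integral0.
Qed.

Let SS_mean a b : supported a -> supported b ->
  \int[P]_w (S a w * S b w) = \sum_i \sum_k a i * b k * r i k.
Proof.
move=> sa sb.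
transitivity (\int[P]_w (\sum_(q : 'I_n * 'I_n) a q.1 * b q.2 * (X q.1 w * X q.2 w))).
  apply: eq_Rintegral => w _; rewrite /S mulr_suml -(pair_bigA _ (fun i k => a i * b k * (X i w * X k w)))/=.
  by apply: eq_bigr => i _; rewrite mulr_sumr; apply: eq_bigr => k _; ring.
rewrite (Rintegral_sum _ (fun q => aXbX_integrable q.1 q.2 sa sb)).2.
rewrite -(pair_bigA _ (fun i k => \int[P]_w (a i * b k * (X i w * X k w))))/=.
apply: eq_bigr => i _; apply: eq_bigr => k _.
have [iA|iA] := boolP (i \in A); last first.
  by rewrite sa//; under eq_Rintegral do rewrite !mul0r; rewrite !mul0r /Rintegral integral0.
have [kA|kA] := boolP (k \in A); last first.
  by rewrite (sb k)// mulr0; under eq_Rintegral do rewrite mul0r; rewrite mul0r /Rintegral integral0.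
by rewrite RintegralZl ?XX_mean//; exact: XX_integrable.
Qed.

Let measurable_S a : measurable_fun setT (S a).
Proof. by apply: measurable_sum => i; exact: measurable_funM. Qed.

(** [jointly_gaussian] only provides some mean and some standard deviation; comparing the first two
    moments of that law with those of the sum identifies them. *)
Let S_law a : supported a -> exists2 sd, 0 <= sd &
  has_normal_law P (S a) 0 sd /\ sd ^+ 2 = \sum_i \sum_k a i * a k * r i k.
Proof.
move=> sa; have [m [sd [sd0 lawS]]] := gaussX a; exists sd => //.
have m0 : m = 0.
  have := normal_law_centered_mean (measurable_S a) sd0 lawS.
  rewrite RintegralB//; last 2 first.
  - exact: (Rintegral_sum _ (fun i => aX_integrable i sa)).1.
  - exact: finite_measure_integrable_cst.
  rewrite S_mean// Rintegral_cst// (_ : fine _ = 1); last first.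
    by have /(congr1 fine) := probability_setT P.
  by rewrite mulr1 sub0r => /eqP; rewrite oppr_eq0 => /eqP.
move: lawS; rewrite m0 => lawS; split => //.
rewrite -(normal_law_centered_second_moment (measurable_S a) sd0 lawS) -SS_mean//.
by apply: eq_Rintegral => w _; rewrite subr0 expr2.
Qed.

(** A combination with weights c of the given combinations is centred normal with variance the sum
    of the c_j^2, so the joint characteristic function factorizes and [prob_le_prod] applies. *)
Lemma orthonormal_combinations_prob (J : finType) (a : J -> 'I_n -> R) (t : J -> R) :
  (forall j i, i \notin A -> a j i = 0) ->
  (forall j l, \sum_i \sum_k a j i * a l k * r i k = (j == l)%:R) ->
  P [set w | forall j, \sum_i a j i * X i w <= t j] = (\prod_j Phi (t j))%:E.
Proof.
move=> sa ortho.
have law1 j : has_normal_law P (S (a j)) 0 1.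
  have [sd sd0 [lawS sd2]] := S_law (sa j).
  suff -> : 1 = sd by [].
  by apply/eqP; rewrite -(@eqrXn2 _ 2)// sd2 ortho eqxx expr1n.
rewrite (@prob_le_prod _ _ _ P J (fun j => S (a j)) (fun=> 1) t).
- congr EFin; apply: eq_bigr => j _; rewrite /Phi; congr fine.
  transitivity (P (S (a j) @^-1` `]-oo, t j])).
    by congr (P _); apply/seteqP; split => w /=; rewrite in_itv.
  by rewrite law1// oner_eq0.
- by move=> j; exact: measurable_S.
- by move=> j; rewrite law1// oner_eq0 normal_prob_set1.
move=> c b.
(* The coefficients, in terms of the X i, of the weighted sum of the combinations. *)
pose ca i := \sum_j c j * a j i.
have sca : supported ca by move=> i iA; rewrite /ca big1// => j _; rewrite sa// mulr0.
have [sd sd0 [lawS sd2]] := S_law sca.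
have := normal_law_cos (measurable_S ca) sd0 lawS 1 b.
rewrite mulr0 add0r mul1r sd2 => h.
rewrite (_ : \prod_i _ = expR (- (\sum_i \sum_k ca i * ca k * r i k) / 2)).
  rewrite -h; apply: eq_Rintegral => w _; congr (cos (_ + b)).
  rewrite mul1r /S /ca; under [RHS]eq_bigr do rewrite mulr_suml.
  rewrite exchange_big/=; apply: eq_bigr => j _; rewrite mulr_sumr.
  by apply: eq_bigr => i _; rewrite mulrA.
rewrite -expR_sum; congr expR; rewrite -mulr_suml sumrN; congr (- _ / 2).
transitivity (\sum_j \sum_l c j * c l * (\sum_i \sum_k a j i * a l k * r i k)).
  apply: eq_bigr => j _; rewrite (bigD1 j)//= [X in _ + X]big1; last first.
    by move=> l lj; rewrite ortho eq_sym (negbTE lj) mulr0.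
  rewrite ortho eqxx addr0 !mulr1; ring.
rewrite /ca; symmetry.
transitivity (\sum_i \sum_k \sum_j \sum_l c j * c l * (a j i * a l k * r i k)).
  apply: eq_bigr => i _; apply: eq_bigr => k _; rewrite !mulr_suml.
  apply: eq_bigr => j _; rewrite -mulrA mulr_suml mulr_sumr.
  by apply: eq_bigr => l _; ring.
under eq_bigr do rewrite exchange_big/=.
rewrite exchange_big/=; apply: eq_bigr => j _.
under eq_bigr do rewrite exchange_big/=.
rewrite exchange_big/=; apply: eq_bigr => l _.
by rewrite mulr_sumr; apply: eq_bigr => i _; rewrite mulr_sumr.
Qed.

End null_combinations.

(** * Finite-sample bounds on the probability of no false rejection *)

Section union_bound.
Context d (T : measurableType d) (R : realType) (P : probability T R).

(** Used in both directions: acceptance is compared with the event that all averages are small, and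
    that event with acceptance. *)
Lemma union_bound (J : finType) (A M : set T) (B : J -> set T) (pM : R) (p : J -> R) :
  measurable A -> measurable M -> (forall i, measurable (B i)) ->
  (forall w, A w -> M w \/ exists i, B i w) ->
  P M = pM%:E -> (forall i, (P (B i) <= (p i)%:E)%E) ->
  (P A <= (pM + \sum_i p i)%:E)%E.
Proof.
move=> mA mM mB AMB PM pB.
have mU (s : seq J) : measurable (\big[setU/set0]_(i <- s) B i).
  exact: bigsetU_measurable.
have PU (s : seq J) : (P (\big[setU/set0]_(i <- s) B i) <= (\sum_(i <- s) p i)%:E)%E.
  elim: s => [|i s IH]; first by rewrite !big_nil measure0.
  rewrite !big_cons EFinD; apply: le_trans (measureU2 P (mB i) (mU s)) _.
  by apply: leeD; [exact: pB|exact: IH].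
apply: (@le_trans _ _ (P (M `|` \big[setU/set0]_(i <- index_enum J) B i))).
  apply: le_measure; rewrite ?inE//; first exact: measurableU.
  move=> w /AMB[Mw|[i Bi]]; [by left|right].
  by rewrite -bigcup_seq; exists i => //=; rewrite mem_index_enum.
apply: le_trans (measureU2 P mM (mU _)) _.
by rewrite EFinD -PM; apply: leeD; [exact: lexx|exact: PU].
Qed.

End union_bound.

Section finite_sample_bounds.
Context d (T : measurableType d) (R : realType) (P : probability T R).
Variables (n m : nat) (X : 'I_n -> {RV P >-> R}) (A : {set 'I_n})
  (bl : 'I_n -> 'I_m) (rho : 'I_m -> R).
Hypotheses (gaussX : jointly_gaussian X) (rho01 : forall j, 0 < rho j < 1)
  (lawX : forall i, i \in A -> has_normal_law P (X i) 0 1)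
  (corrX : forall i k, i \in A -> k \in A -> i != k ->
     correlation P (X i) (X k) = if bl i == bl k then rho (bl i) else 0).

Definition block_nulls j : {set 'I_n} := [set i in A | bl i == j]%SET.
Hypothesis A_neq0 : forall j, (0 < #|block_nulls j|)%N.

Let k0 j : R := #|block_nulls j|%:R.

Let k0_gt0 j : 0 < k0 j. Proof. by rewrite ltr0n. Qed.

(* The average of the X i over a block of true nulls has standard deviation
   mean_sd; subtracting mean_coef times the standardized average, rather than
   the average itself, leaves residuals that are exactly uncorrelated. *)
Definition mean_sd (k : nat) (r : R) := Num.sqrt (r + (1 - r) / k%:R).
Definition mean_coef (k : nat) (r : R) := mean_sd k r - Num.sqrt ((1 - r) / k%:R).

Lemma mean_coef_gt0 (k : nat) (r : R) : (0 < k)%N -> 0 < r < 1 ->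
  0 < mean_coef k r.
Proof.
move=> k_gt0 /andP[r0 r1]; have v0 : 0 < (1 - r) / k%:R.
  by rewrite divr_gt0 ?ltr0n// subr_gt0.
by rewrite subr_gt0 ltr_sqrt ?addr_gt0// ltrDr.
Qed.

Let h j := (1 - rho j) / k0 j.
Let u j := mean_sd #|block_nulls j| (rho j).
Let c j := mean_coef #|block_nulls j| (rho j).
Let s j := Num.sqrt (1 - rho j).

Let h_gt0 j : 0 < h j.
Proof. by rewrite divr_gt0// subr_gt0; case/andP: (rho01 j). Qed.

Let u_sqr j : u j ^+ 2 = rho j + h j.
Proof.
by rewrite sqr_sqrtr// addr_ge0 ?(ltW (h_gt0 j))//; case/andP: (rho01 j) => /ltW.
Qed.

Let u_gt0 j : 0 < u j.
Proof.
by rewrite sqrtr_gt0 addr_gt0 ?(h_gt0 j)//; case/andP: (rho01 j).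
Qed.

Let c_gt0 j : 0 < c j. Proof. exact: mean_coef_gt0. Qed.

Let s_sqr j : s j ^+ 2 = 1 - rho j.
Proof. by rewrite sqr_sqrtr// subr_ge0 ltW//; case/andP: (rho01 j). Qed.

Let s_gt0 j : 0 < s j.
Proof. by rewrite sqrtr_gt0 subr_gt0; case/andP: (rho01 j). Qed.

Let k0_neq0 j : k0 j != 0. Proof. exact: lt0r_neq0. Qed.

Let u_neq0 j : u j != 0. Proof. exact: lt0r_neq0. Qed.

Let s_neq0 j : s j != 0. Proof. exact: lt0r_neq0. Qed.

Let r i k : R := if i == k then 1 else if bl i == bl k then rho (bl i) else 0.

Let corr_r i k : i \in A -> k \in A -> i != k -> correlation P (X i) (X k) = r i k.
Proof. by move=> iA kA ik; rewrite corrX// /r (negbTE ik). Qed.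

Let r_diag i : i \in A -> r i i = 1.
Proof. by rewrite /r eqxx. Qed.

(** On each block [r] is rho times the all-ones matrix plus 1 - rho times the identity, and it
    vanishes between blocks. *)
Let form (a b : 'I_n -> R) : \sum_i \sum_k a i * b k * r i k =
  \sum_i a i * (rho (bl i) * (\sum_(k | bl k == bl i) b k) + (1 - rho (bl i)) * b i).
Proof.
apply: eq_bigr => i _.
transitivity (a i * (\sum_k b k * r i k)).
  by rewrite mulr_sumr; apply: eq_bigr => k _; rewrite mulrA.
congr (_ * _); rewrite mulr_sumr (bigD1 i)//= [in RHS](bigD1 i)//=.
rewrite {1}/r eqxx [X in _ + X = _](_ : _ = \sum_(k | (bl k == bl i) && (k != i)) rho (bl i) * b k).
  ring.
rewrite [RHS]big_mkcond/= [LHS]big_mkcond/=; apply: eq_bigr => k _.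
rewrite /r (eq_sym i k) (eq_sym (bl i)); case: eqVneq => /= ki; rewrite ?andbF//= andbT.
by case: ifP => _; rewrite ?mulr0// mulrC.
Qed.

(** Coefficients of the average of the true nulls of block j, divided by its standard deviation
    [u j]. *)
Let z j i : R := if i \in block_nulls j then (k0 j * u j)^-1 else 0.
Let Z j w := \sum_i z j i * X i w.

Let e j l i : R := ((i == l)%:R - c j * z j i) / s j.
Let E j l w := \sum_i e j l i * X i w.

Let in_block j i : (i \in block_nulls j) = (i \in A) && (bl i == j).
Proof. by rewrite inE. Qed.

Let z_supp j i : i \notin A -> z j i = 0.
Proof. by move=> iA; rewrite /z in_block (negbTE iA). Qed.

Let sum_z_all j : \sum_(k in block_nulls j) z j k = (u j)^-1.
Proof.
transitivity (\sum_(k in block_nulls j) (k0 j * u j)^-1).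
  by apply: eq_bigr => k kj; rewrite /z kj.
rewrite sumr_const -mulr_natl -/(k0 j).
by field; rewrite ?k0_neq0 ?u_neq0 ?s_neq0.
Qed.

Let sum_z j l : \sum_(k | bl k == j) z l k = if j == l then (u j)^-1 else 0.
Proof.
case: eqVneq => [<-|jl]; last first.
  by rewrite big1// => k /eqP kj; rewrite /z in_block kj (negbTE jl) andbF.
rewrite -sum_z_all big_mkcond [RHS]big_mkcond/=; apply: eq_bigr => k _.
rewrite in_block; case: ifP => /= kj; rewrite ?andbF// andbT.
by case: ifPn => // /z_supp.
Qed.

Let Z_ortho j l : \sum_i \sum_k z j i * z l k * r i k = (j == l)%:R.
Proof.
rewrite form.
transitivity (\sum_(i in block_nulls j) z j i *
    (if j == l then rho j * (u j)^-1 + (1 - rho j) * (k0 j * u j)^-1 else 0)).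
  rewrite [RHS]big_mkcond/=; apply: eq_bigr => i _.
  case: ifP => [ij|ij]; last by rewrite /z ij mul0r.
  have /andP[iA /eqP bij] : (i \in A) && (bl i == j) by rewrite -in_block.
  rewrite sum_z bij; congr (_ * _); case: eqVneq => [<-|jl].
    by rewrite /z ij.
  by rewrite {1}/z in_block bij (negbTE jl) andbF !mulr0 addr0.
rewrite -mulr_suml sum_z_all; case: eqVneq => [_|_]; last by rewrite mulr0.
have := u_sqr j; rewrite /h => u2.
have -> : (u j)^-1 * (rho j * (u j)^-1 + (1 - rho j) * (k0 j * u j)^-1) =
   (rho j + (1 - rho j) / k0 j) / u j ^+ 2.
  by field; rewrite ?k0_neq0 ?u_neq0 ?s_neq0.
by rewrite -u2 divff// expf_neq0.
Qed.

(** Each X_i has covariance u with Z, so distinct residuals have covariance rho - 2 c u + c^2, which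
    is 0 for c = u - sqrt h because u^2 = rho + h; their variance is then 1 - rho = s^2. *)
Let E_ortho j i l : i \in block_nulls j -> l \in block_nulls j ->
  \sum_p \sum_k e j i p * e j l k * r p k = (i == l)%:R.
Proof.
move=> ij lj; rewrite form.
(* [zeta] is the weight of one null in Z, and [g] is the sum of the coefficients of a standardized
   residual. *)
pose zeta := (k0 j * u j)^-1; pose g := (1 - c j / u j) / s j.
have e_block q k : q \in block_nulls j -> k \notin block_nulls j -> e j q k = 0.
  move=> qj kj; rewrite /e /z (negbTE kj) mulr0 subr0 (_ : (k == q) = false) ?mul0r//.
  by apply/negbTE; apply: contraNneq kj => ->.
have sum_e q : q \in block_nulls j -> \sum_(k in block_nulls j) e j q k = g.
  move=> qj; rewrite -mulr_suml /g; congr (_ / _); rewrite sumrB -mulr_sumr sum_z_all.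
  congr (_ - _); rewrite (bigD1 q)//= eqxx big1 ?addr0// => k /andP[_ /negbTE ->].
  by [].
have sum_e' q : q \in block_nulls j -> \sum_(k | bl k == j) e j q k = g.
  move=> qj; rewrite -(sum_e q qj) big_mkcond [RHS]big_mkcond/=; apply: eq_bigr => k _.
  case: ifPn => kj; case: ifPn => kj'//; first exact: e_block.
  by move: kj'; rewrite in_block (negbTE kj) andbF.
transitivity (\sum_(q in block_nulls j) (e j i q * (rho j * g) +
    (1 - rho j) * (e j i q * e j l q))).
  rewrite [RHS]big_mkcond/=; apply: eq_bigr => q _.
  case: ifPn => qj; last by rewrite e_block// mul0r.
  have /andP[_ /eqP bq] : (q \in A) && (bl q == j) by rewrite -in_block.
  by rewrite bq sum_e'//; ring.
rewrite big_split/= -mulr_suml -mulr_sumr sum_e//.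
have -> : \sum_(q in block_nulls j) e j i q * e j l q =
    ((i == l)%:R - 2 * c j * zeta + k0 j * (c j * zeta) ^+ 2) / (s j) ^+ 2.
  transitivity (\sum_(q in block_nulls j)
     (((q == i)%:R * (q == l)%:R - ((q == i)%:R + (q == l)%:R) * (c j * zeta)
        + (c j * zeta) ^+ 2) / (s j) ^+ 2)).
    apply: eq_bigr => q qj; rewrite /e /z qj -/zeta; field.
    by rewrite ?k0_neq0 ?u_neq0 ?s_neq0.
  rewrite -mulr_suml; congr (_ / _); rewrite big_split/= sumrB -mulr_suml.
  rewrite sumr_const -mulr_natl -/(k0 j) big_split/=.
  have one q0 : q0 \in block_nulls j -> \sum_(q in block_nulls j) (q == q0)%:R = 1 :> R.
    move=> qj; rewrite (bigD1 q0)//= eqxx big1 ?addr0// => k /andP[_ /negbTE ->].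
    by [].
  rewrite !one//; congr (_ - _ + _); [|by ring|by ring].
  rewrite (bigD1 i)//= eqxx mul1r big1 ?addr0 ?mulr1// => k /andP[_ /negbTE ->].
  by rewrite mul0r.
have k2 : Num.sqrt (h j) ^+ 2 = h j by rewrite sqr_sqrtr// ltW// h_gt0.
have cE : c j = u j - Num.sqrt (h j) by [].
have hE : Num.sqrt (h j) ^+ 2 = s j ^+ 2 / k0 j by rewrite k2 s_sqr.
have rE : rho j = 1 - s j ^+ 2 by rewrite s_sqr; ring.
have u2 : u j ^+ 2 = 1 - s j ^+ 2 + s j ^+ 2 / k0 j by rewrite u_sqr -k2 hE rE.
rewrite /g /zeta cE rE; move: hE u2; set kap := Num.sqrt (h j) => hE u2.
(* The bracket vanishes: kap^2 = s^2 / k0 and u^2 - kap^2 = 1 - s^2 make both of its terms (1 - s^2)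
   / k0. *)
transitivity ((i == l)%:R + ((1 - s j ^+ 2) * kap ^+ 2 / (s j ^+ 2) - (u j ^+ 2 - kap ^+ 2) / k0 j)
   / u j ^+ 2).
  by field; rewrite ?k0_neq0 ?u_neq0 ?s_neq0.
rewrite (_ : _ - _ / k0 j = 0) ?mul0r ?addr0// hE u2.
by field; rewrite ?k0_neq0 ?s_neq0.
Qed.

Let X_decomp j i w : i \in block_nulls j -> X i w = s j * E j i w + c j * Z j w.
Proof.
move=> ij; rewrite /E /Z !mulr_sumr -big_split/= (bigD1 i)//= big1 ?addr0.
  by rewrite /e eqxx/=; field; rewrite ?k0_neq0 ?u_neq0 ?s_neq0.
move=> k ki; rewrite /e (negbTE ki)/=; by field; rewrite ?k0_neq0 ?u_neq0 ?s_neq0.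
Qed.

Let e_supp j l i : l \in block_nulls j -> i \notin A -> e j l i = 0.
Proof.
move=> lj iA; rewrite /e z_supp// mulr0 subr0.
rewrite (_ : (i == l) = false) ?mul0r//; apply/negbTE/eqP => il.
by move: iA; rewrite il; move: lj; rewrite in_block => /andP[->].
Qed.

Lemma prob_means (y : 'I_m -> R) :
  P [set w | forall j, Z j w <= y j] = (\prod_j Phi (y j))%:E.
Proof.
have := @orthonormal_combinations_prob _ _ _ P n X A r gaussX lawX r_diag corr_r.
by move=> /(_ _ z y z_supp Z_ortho).
Qed.

Let J j : finType := {i : 'I_n | i \in block_nulls j}.

Lemma prob_residuals j (x : R) :
  P [set w | forall i, i \in block_nulls j -> E j i w <= x] =
  (Phi x ^+ #|block_nulls j|)%:E.
Proof.
have ortho (p q : J j) :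
    \sum_i \sum_k e j (val p) i * e j (val q) k * r i k = (p == q)%:R.
  by rewrite (E_ortho (valP p) (valP q)).
have PE := @orthonormal_combinations_prob _ _ _ P n X A r gaussX lawX r_diag corr_r
  (J j) (fun p => e j (val p)) (fun=> x) (fun p i => @e_supp _ _ i (valP p)) ortho.
transitivity (P [set w | forall p : J j, E j (val p) w <= x]).
  congr (P _); apply/seteqP; split => w /= H; first by move=> p; exact: H (valP p).
  by move=> i ij; exact: (H (exist _ i ij)).
by rewrite [LHS]PE prodr_const card_sig.
Qed.

Let measurable_comb (a : 'I_n -> R) : measurable_fun setT (fun w => \sum_i a i * X i w).
Proof. by apply: measurable_sum => i; exact: measurable_funM. Qed.

Let measurable_le (f : T -> R) (t : R) : measurable_fun setT f ->
  measurable [set w | f w <= t].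
Proof.
move=> mf; rewrite (_ : [set w | _] = f @^-1` [set` `]-oo, t]]).
  by rewrite -[X in measurable X]setTI; exact: mf.
by apply/seteqP; split => w /=; rewrite in_itv.
Qed.

Let measurable_forall (I : finType) (F : I -> set T) : (forall i, measurable (F i)) ->
  measurable [set w | forall i, F i w].
Proof.
move=> mF; rewrite (_ : [set w | _] = \bigcap_(i in [set: I]) F i).
  by apply: fin_bigcap_measurable => //; exact: finite_finset.
by apply/seteqP; split => w /= H i; [move=> _|]; exact: H.
Qed.

Let measurable_forall_in (I : finType) (B : pred I) (F : I -> set T) :
  (forall i, measurable (F i)) -> measurable [set w | forall i, B i -> F i w].
Proof.
move=> mF; apply: (measurable_forall (F := fun i => [set w | B i -> F i w])) => i.
case: (B i).
  by rewrite (_ : [set w | _] = F i)//; apply/seteqP; split => w /=; [exact|move=> ? _].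
by rewrite (_ : [set w | _] = setT)//; apply/seteqP; split => w.
Qed.

Lemma prob_residual_gt j i (x : R) : i \in block_nulls j ->
  P [set w | x < E j i w] = (1 - Phi x)%:E.
Proof.
move=> ij.
(* The law of a single residual is read off from a family with one member. *)
have ortho (p q : 'I_1) : \sum_k \sum_k' e j i k * e j i k' * r k k' = (p == q)%:R.
  by rewrite E_ortho// eqxx !ord1 eqxx.
have := @orthonormal_combinations_prob _ _ _ P n X A r gaussX lawX r_diag corr_r
  'I_1 (fun=> e j i) (fun=> x) (fun _ i => @e_supp _ _ i ij) ortho.
rewrite big_ord1 => PE.
have -> : [set w | x < E j i w] = ~` [set w | forall p : 'I_1, E j i w <= x].
  apply/seteqP; split => w /=; first by move=> xE /(_ ord0); rewrite leNgt xE.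
  by move=> H; rewrite ltNge; apply/negP => Ex; apply: H.
rewrite probability_setC; first by rewrite EFinB -PE.
by apply: measurable_forall => _; apply: measurable_le; exact: measurable_comb.
Qed.

Variables (cut x y : 'I_m -> R).

Let Acc := [set w | forall i, i \in A -> X i w <= cut (bl i)].

Let mAcc : measurable Acc.
Proof. by apply: measurable_forall_in => i; exact: measurable_le. Qed.

Let mZ : measurable [set w | forall j, Z j w <= y j].
Proof.
by apply: measurable_forall => j; apply: measurable_le; exact: measurable_comb.
Qed.

(** If nothing is rejected but some average exceeds y_j, then all residuals of block j must lie
    below x_j, and these are independent. *)
Lemma prob_accept_le : (forall j, cut j <= s j * x j + c j * y j) ->
  (P Acc <= (\prod_j Phi (y j) + \sum_j Phi (x j) ^+ #|block_nulls j|)%:E)%E.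
Proof.
move=> cutle; apply: (union_bound mAcc mZ
  (B := fun j => [set w | forall i, i \in block_nulls j -> E j i w <= x j])).
- move=> j; apply: measurable_forall_in => i.
  by apply: measurable_le; exact: measurable_comb.
- move=> w Aw; have [Zy|/existsNP[j /negP]] := pselect (forall j, Z j w <= y j).
    by left.
  rewrite -ltNge => yZ; right; exists j => i ij /=.
  have /andP[iA /eqP bij] : (i \in A) && (bl i == j) by rewrite -in_block.
  have := Aw i iA; rewrite (X_decomp w ij) bij => /le_trans/(_ (cutle j)) le1.
  rewrite -(ler_pM2l (s_gt0 j)).
  have : c j * y j < c j * Z j w by rewrite ltr_pM2l.
  by move: le1; lra.
- exact: prob_means.
- by move=> j; rewrite prob_residuals.
Qed.

(** If all averages are at most y_j, a rejection forces the residual of the rejected null above x_j.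
    These events are summed over the true nulls. *)
Lemma prob_accept_ge : (forall j, s j * x j + c j * y j <= cut j) ->
  ((\prod_j Phi (y j))%:E <=
   P Acc + (\sum_j #|block_nulls j|%:R * (1 - Phi (x j)))%:E)%E.
Proof.
move=> lecut; rewrite -prob_means.
pose B i := if i \in A then [set w | x (bl i) < E (bl i) i w] else set0.
pose p i := if i \in A then 1 - Phi (x (bl i)) else 0.
have in_bl i : i \in A -> i \in block_nulls (bl i) by move=> iA; rewrite in_block iA eqxx.
have -> : \sum_j #|block_nulls j|%:R * (1 - Phi (x j)) = \sum_i p i.
  rewrite /p -big_mkcond (partition_big bl xpredT)//=; apply: eq_bigr => j _.
  transitivity (\sum_(i in block_nulls j) (1 - Phi (x j))).
    by rewrite sumr_const mulr_natl.
  rewrite [LHS]big_mkcond [RHS]big_mkcond/=; apply: eq_bigr => i _.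
  by rewrite in_block; case: (i \in A) => //=; case: eqVneq => [->|].
have PA : P Acc = (fine (P Acc))%:E by rewrite fineK// fin_num_measure.
rewrite PA -EFinD; apply: (union_bound mZ mAcc (B := B)) => //.
- move=> i; rewrite /B; case: ifP => // iA.
  rewrite (_ : [set w | _] = ~` [set w | E (bl i) i w <= x (bl i)]).
    by apply: measurableC; apply: measurable_le; exact: measurable_comb.
  by apply/seteqP; split => w /=; rewrite ltNge => /negP.
- move=> w Zw; have [Aw|] := pselect (Acc w); [by left|].
  move=> /existsNP[i /not_implyP[iA /negP]]; rewrite -ltNge => cutX.
  right; exists i; rewrite /B iA /=; rewrite -(ltr_pM2l (s_gt0 (bl i))).
  move: cutX; rewrite (X_decomp w (in_bl i iA)); have := lecut (bl i).
  have : c (bl i) * Z (bl i) w <= c (bl i) * y (bl i) by rewrite ler_pM2l//; exact: Zw.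
  by lra.
- move=> i; rewrite /B /p; case: ifP => iA; last by rewrite measure0.
  by rewrite prob_residual_gt// in_bl.
Qed.

End finite_sample_bounds.

(** * Asymptotics inside one block *)

Definition max_quantile (R : realType) (k : nat) : R := Phi_inv (1 - k%:R^-1).

(* The maximum of k independent standard normals lies within this distance of
   [max_quantile R k] with probability tending to 1. *)
Definition max_window (R : realType) (k : nat) : R := (Num.sqrt (max_quantile R k))^-1.

Section block_asymptotics.
Variables (R : realType) (k k0 : nat -> nat) (lam r b : R).
Hypotheses (k_oo : k n @[n --> \oo] --> \oo) (k0_le : forall n, (k0 n <= k n)%N)
  (lam_gt0 : 0 < lam) (k0k : (k0 n)%:R / (k n)%:R @[n --> \oo] --> lam)
  (r01 : 0 < r < 1) (b01 : 0 < b < 1).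

Local Notation q n := (max_quantile R (k n)).
Local Notation delta n := (max_window R (k n)).

Let k_ge (M : R) : \forall n \near \oo, M <= (k n)%:R.
Proof.
have [N MN] : exists N : nat, M <= N%:R.
  by exists (Num.bound `|M|); rewrite ltW// (le_lt_trans (ler_norm _))// archi_boundP.
near=> n; apply: le_trans MN _; rewrite ler_nat; near: n.
by move/cvgnyPge : k_oo; apply.
Unshelve. all: by end_near. Qed.

(** For k = 1 the argument of [Phi_inv] would be 0, where it takes its default value. *)
Let Phi_q n : (1 < k n)%N -> Phi (q n) = 1 - (k n)%:R^-1.
Proof.
move=> k1; have k1R : 1 < (k n)%:R :> R by rewrite ltr1n.
have k_gt0 : 0 < (k n)%:R :> R by apply: lt_trans k1R.
apply: Phi_invK; apply/andP; split; first by rewrite subr_gt0 invf_lt1.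
by rewrite ltrBlDr ltrDl invr_gt0.
Qed.

Lemma cvg_quantile : q n @[n --> \oo] --> +oo.
Proof.
apply/cvgryPge => M; have M1 : 0 < 1 - Phi M.
  rewrite subr_gt0 (@lt_le_trans _ _ (Phi (M + 1)))//; first by rewrite Phi_lt// ltrDl.
  by rewrite -lee_fin -Phi_EFin probability_le1.
near=> n; have k1 : (1 < k n)%N.
  have : 2 <= (k n)%:R :> R by near: n; exact: k_ge.
  by rewrite (ler_nat R 2).
have : (1 - Phi M)^-1 <= (k n)%:R by near: n; exact: k_ge.
have k_gt0 : 0 < (k n)%:R :> R by rewrite ltr0n ltnW.
move=> kM; rewrite -Phi_le Phi_q//.
have : (k n)%:R^-1 <= 1 - Phi M.
  by rewrite -[leRHS]invrK lef_pV2 ?posrE ?invr_gt0.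
by lra.
Unshelve. all: by end_near. Qed.

Lemma cvg_delta : delta n @[n --> \oo] --> 0.
Proof.
have h : Num.sqrt (q n) @[n --> \oo] --> +oo.
  apply/cvgryPge => M; near=> n.
  have qM : M ^+ 2 <= q n by near: n; move/cvgryPge: cvg_quantile; apply.
  apply: le_trans (ler_norm M) _; rewrite -sqrtr_sqr ler_wsqrtr//.
apply/(gtr0_cvgV0 (f := fun n => Num.sqrt (q n))) => //.
near=> n; rewrite sqrtr_gt0.
by near: n; move/cvgryPgt: cvg_quantile; apply.
Unshelve. all: by end_near. Qed.

Let near_block : \forall n \near \oo, [/\ (1 < k n)%N, (0 < k0 n)%N, 1 <= q n &
  delta n * q n = Num.sqrt (q n)].
Proof.
near=> n.
have q1 : 1 <= q n by near: n; move/cvgryPge: cvg_quantile; apply.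
have k1 : (1 < k n)%N.
  have : 2 <= (k n)%:R :> R by near: n; exact: k_ge.
  by rewrite (ler_nat R 2).
have k00 : (0 < k0 n)%N.
  have : lam / 2 < (k0 n)%:R / (k n)%:R.
    by near: n; move/cvgr_gt : k0k; apply; rewrite ltr_pdivrMr// ltr_pMr// ltr1n.
  rewrite lt0n => lam2; apply/eqP => k00; move: lam2.
  by rewrite k00 mul0r ltNge divr_ge0// ltW.
split => //.
rewrite /max_window -[X in _ * X = _](sqr_sqrtr (le_trans ler01 q1)) expr2 mulKf//.
by rewrite gt_eqF// sqrtr_gt0 (lt_le_trans _ q1).
Unshelve. all: by end_near. Qed.

(* At q the tail is 1 / k, so at q + delta it is at most exp (- sqrt q) / k. *)
Lemma cvg_upper_tail :
  (k0 n)%:R * (1 - Phi (q n + delta n)) @[n --> \oo] --> 0.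
Proof.
(* The bound exp (- sqrt q) is at most 1 / sqrt q, which is delta itself. *)
apply: (squeeze_cvgr _ (cvg_cst 0) cvg_delta); near=> n.
have [k1 k00 q1 dq] : [/\ (1 < k n)%N, (0 < k0 n)%N, 1 <= q n & delta n * q n = Num.sqrt (q n)].
  by near: n; exact: near_block.
have k_gt0 : 0 < (k n)%:R :> R by rewrite ltr0n ltnW.
have sq0 : 0 < Num.sqrt (q n) by rewrite sqrtr_gt0 (lt_le_trans _ q1).
have d0 : 0 <= delta n by rewrite invr_ge0 ltW.
have Phi1 x : Phi x <= 1 :> R.
  by rewrite -lee_fin -Phi_EFin probability_le1.
rewrite mulr_ge0 ?subr_ge0//=.
have := Phi_tail (q n) d0; rewrite Phi_q// dq => tail.
apply: (@le_trans _ _ ((k n)%:R * (expR (- Num.sqrt (q n)) * (1 - (1 - (k n)%:R^-1))))).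
  by rewrite ler_pM ?subr_ge0// ler_nat.
rewrite (_ : _ * _ = expR (- Num.sqrt (q n))); last by field; rewrite gt_eqF.
rewrite expRN /max_window lef_pV2 ?posrE ?expR_gt0//.
by apply: le_trans (expR_ge1Dx _); rewrite lerDr.
Unshelve. all: by end_near. Qed.

(** With p the tail at q - delta, the power is (1 - p)^k0 <= 1 / (1 + k0 p). Since p is at least exp
    (sqrt q - 1) / k and k0 / k has a positive limit, k0 p tends to infinity. *)
Lemma cvg_lower_tail : Phi (q n - delta n) ^+ k0 n @[n --> \oo] --> (0 : R).
Proof.
have h : ((k0 n)%:R / (k n)%:R)^-1 * (expR 1 * delta n) @[n --> \oo] --> (0 : R).
  rewrite -(mulr0 lam^-1); apply: cvgM.
    by apply: cvgV => //; rewrite gt_eqF.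
  by rewrite -(mulr0 (expR 1)); apply: cvgM; [exact: cvg_cst|exact: cvg_delta].
apply: (squeeze_cvgr _ (cvg_cst 0) h); near=> n.
have [k1 k00 q1 dq] : [/\ (1 < k n)%N, (0 < k0 n)%N, 1 <= q n & delta n * q n = Num.sqrt (q n)].
  by near: n; exact: near_block.
have k_gt0 : 0 < (k n)%:R :> R by rewrite ltr0n ltnW.
have k0_gt0 : 0 < (k0 n)%:R :> R by rewrite ltr0n.
have sq1 : 1 <= Num.sqrt (q n) by rewrite -sqrtr1 ler_wsqrtr.
have sq0 : 0 < Num.sqrt (q n) by rewrite (lt_le_trans _ sq1).
have d0 : 0 <= delta n by rewrite invr_ge0 ltW.
have d1 : delta n <= 1 by rewrite /max_window invf_le1.
rewrite exprn_ge0 ?Phi_ge0//=; set x := q n - delta n.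
have := Phi_tail x d0; rewrite /x subrK Phi_q// -/x.
set p := 1 - Phi x => tail.
have Phi1 : Phi x <= 1 :> R by rewrite -lee_fin -Phi_EFin probability_le1.
have p01 : 0 <= p <= 1 by rewrite /p subr_ge0 Phi1 lerBlDr lerDl Phi_ge0.
have -> : Phi x = 1 - p by rewrite /p; ring.
apply: le_trans (expr_onem_le _ p01) _.
(* [Phi_tail] from x = q - delta up to q: the exponent delta * x is sqrt q - delta^2, and delta <= 1
   accounts for the - 1. *)
have pge : expR (Num.sqrt (q n) - 1) / (k n)%:R <= p.
  have e1 : expR (- (delta n * x)) <= expR (1 - Num.sqrt (q n)).
    rewrite ler_expR /x mulrBr dq.
    have : delta n * delta n <= 1 by rewrite mulr_ile1.
    lra.
  have p0 : 0 <= p by case/andP: p01.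
  have := le_trans tail (ler_wpM2r p0 e1).
  rewrite (_ : 1 - (1 - _) = (k n)%:R^-1); last by ring.
  rewrite (_ : 1 - Num.sqrt (q n) = - (Num.sqrt (q n) - 1)); last by ring.
  by rewrite expRN ler_pdivlMl ?expR_gt0.
have pp : 0 < p by apply: lt_le_trans pge; rewrite divr_gt0 ?expR_gt0.
apply: (@le_trans _ _ ((k0 n)%:R * (expR (Num.sqrt (q n) - 1) / (k n)%:R))^-1).
  rewrite lef_pV2 ?posrE; last 2 first.
  - by rewrite ltr_wpDr// mulr_ge0// ltW.
  - by rewrite mulr_gt0// divr_gt0 ?expR_gt0.
  by apply: (@le_trans _ _ ((k0 n)%:R * p)); rewrite ?ler_pM2l// lerDr.
rewrite expRD expRN.
rewrite (_ : _^-1 = ((k0 n)%:R / (k n)%:R)^-1 * (expR 1 * (expR (Num.sqrt (q n)))^-1)); last first.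
  by field; rewrite !gt_eqF ?expR_gt0.
rewrite ler_pM2l ?invr_gt0 ?divr_gt0// ler_pM2l ?expR_gt0//.
rewrite /max_window lef_pV2 ?posrE ?expR_gt0//.
by apply: le_trans (expR_ge1Dx _); rewrite lerDr.
Unshelve. all: by end_near. Qed.

Let k0_inv : (k0 n)%:R^-1 @[n --> \oo] --> (0 : R).
Proof.
apply/(gtr0_cvgV0 (f := fun n => (k0 n)%:R)); last first.
  apply/cvgryPge => M; near=> n.
  have [k1 k00 _ _] : [/\ (1 < k n)%N, (0 < k0 n)%N, 1 <= q n & delta n * q n = Num.sqrt (q n)].
    by near: n; exact: near_block.
  have k_gt0 : 0 < (k n)%:R :> R by rewrite ltr0n ltnW.
  have : lam / 2 < (k0 n)%:R / (k n)%:R.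
    by near: n; move/cvgr_gt : k0k; apply; rewrite ltr_pdivrMr// ltr_pMr// ltr1n.
  rewrite ltr_pdivlMr// => /ltW; apply: le_trans.
  by rewrite -ler_pdivrMl ?divr_gt0//; near: n; exact: k_ge.
near=> n; rewrite ltr0n.
by have [] : [/\ (1 < k n)%N, (0 < k0 n)%N, 1 <= q n & delta n * q n = Num.sqrt (q n)]
  by near: n; exact: near_block.
Unshelve. all: by end_near. Qed.

Lemma cvg_mean_coef : mean_coef (k0 n) r @[n --> \oo] --> Num.sqrt r.
Proof.
have h : (1 - r) / (k0 n)%:R @[n --> \oo] --> 0.
  by rewrite -(mulr0 (1 - r)); apply: cvgM; [exact: cvg_cst|exact: k0_inv].
rewrite -[X in _ --> X]subr0 -{1}(@sqrtr0 R); apply: cvgB.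
  apply: continuous_cvg; first exact: sqrt_continuous.
  by rewrite -[X in _ --> X](addr0 r); apply: cvgD; [exact: cvg_cst|].
by apply: continuous_cvg; first exact: sqrt_continuous.
Qed.

(** The shift e * delta disappears in the limit, so the thresholds used for the lower and the upper
    bound, which differ only in [e], give the same value Phi (- Phi_inv b). *)
Lemma cvg_Phi_mean (e : R) :
  Phi ((- (Num.sqrt r * Phi_inv b) + e * delta n) / mean_coef (k0 n) r)
    @[n --> \oo] --> 1 - b.
Proof.
have sr : Num.sqrt r != 0 by rewrite gt_eqF// sqrtr_gt0; case/andP: r01.
have -> : 1 - b = Phi ((- (Num.sqrt r * Phi_inv b) + e * 0) / Num.sqrt r).
  rewrite -(Phi_invK b01) -PhiN; congr Phi; rewrite mulr0 addr0 mulNr.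
  by rewrite Phi_invK// mulrC mulKf.
apply: continuous_cvg; first exact: continuous_Phi.
apply: cvgM; last by apply: cvgV => //; exact: cvg_mean_coef.
apply: cvgD; first exact: cvg_cst.
by apply: cvgM; [exact: cvg_cst|exact: cvg_delta].
Qed.

End block_asymptotics.

(** * Combination of the blocks and passage to the limit *)

Lemma bigmin_minn_le (I : eqType) (s : seq I) (x : nat) (F : I -> nat) (j : I) :
  j \in s -> (\big[minn/x]_(i <- s) F i <= F j)%N.
Proof.
elim: s => // i s IH; rewrite inE big_cons geq_min => /predU1P[->|/IH ->].
  by rewrite leqnn.
by rewrite orbT.
Qed.

Lemma cvg_big_prod (R : realType) (I : Type) (s : seq I) (f : I -> nat -> R) (l : I -> R) :
  (forall i, f i n @[n --> \oo] --> l i) ->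
  \prod_(i <- s) f i n @[n --> \oo] --> \prod_(i <- s) l i.
Proof.
move=> fl; elim: s => [|i s IH].
  by rewrite big_nil; under eq_fun do rewrite big_nil; exact: cvg_cst.
by rewrite big_cons; under eq_fun do rewrite big_cons; exact: cvgM.
Qed.

Lemma cvg_big_sum0 (R : realType) (I : Type) (s : seq I) (f : I -> nat -> R) :
  (forall i, f i n @[n --> \oo] --> (0 : R)) ->
  \sum_(i <- s) f i n @[n --> \oo] --> (0 : R).
Proof.
move=> fl; elim: s => [|i s IH].
  by under eq_fun do rewrite big_nil; exact: cvg_cst.
under eq_fun do rewrite big_cons.
by have := cvgD (fl i) IH; rewrite addr0; apply.
Qed.

Lemma sidak_level (R : realType) (m : nat) (alpha : R) : (1 <= m)%N -> 0 < alpha < 1 ->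
  let b := 1 - (1 - alpha) `^ (m%:R^-1) in 0 < b < 1 /\ (1 - b) ^+ m = 1 - alpha.
Proof.
move=> m1 /andP[a0 a1] b.
have bE : 1 - b = (1 - alpha) `^ (m%:R^-1) by rewrite /b; ring.
have pow : (1 - b) ^+ m = 1 - alpha.
  rewrite bE -powR_mulrn ?powR_ge0// -powRrM mulVf ?powRr1//.
    by rewrite subr_ge0 ltW.
  by rewrite pnatr_eq0 -lt0n.
split=> //; apply/andP; split; last first.
  by rewrite -subr_gt0 bE powR_gt0// subr_gt0.
rewrite ltNge; apply/negP => b0.
have : 1 <= (1 - b) ^+ m by rewrite exprn_ege1// lerBrDr gerDl.
by rewrite pow; lra.
Qed.

(* In the two minima below the initial values n and 1 are upper bounds of the
   terms, so that (as 0 < m) they do not affect the minimum. *)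
Theorem theorem5p1 (R : realType) (m : nat) (hm : (1 <= m)%N)
  (alpha : R) (halpha : 0 < alpha < 1)
  (rho : 'I_m -> R) (hrho : forall j, 0 < rho j < 1)
  (beta : R) (hbeta : beta = 1 - (1 - alpha) `^ (m%:R^-1))
  (I : forall n : nat, 'I_m -> {set 'I_n})
  (hcover : forall n : nat, (\bigcup_(j < m) I n j)%SET = [set: 'I_n]%SET)
  (hdisj : forall (n : nat) (j j' : 'I_m), j != j' ->
     ([disjoint I n j & I n j'])%B)
  (d : nat -> measure_display) (T : forall n : nat, measurableType (d n))
  (P : forall n : nat, probability (T n) R)
  (X : forall n : nat, 'I_n -> {RV (P n) >-> R})
  (mu : forall n : nat, 'I_n -> R) (hmu : forall (n : nat) (i : 'I_n), 0 <= mu n i)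
  (hgauss : forall n : nat, jointly_gaussian (X n))
  (hmarginal : forall (n : nat) (i : 'I_n), has_normal_law (P n) (X n i) (mu n i) 1)
  (hcorr_same : forall (n : nat) (j : 'I_m) (i i' : 'I_n), i != i' ->
    i \in I n j -> i' \in I n j -> correlation (P n) (X n i) (X n i') = rho j)
  (hcorr_diff : forall (n : nat) (j j' : 'I_m) (i i' : 'I_n), j != j' ->
    i \in I n j -> i' \in I n j' -> correlation (P n) (X n i) (X n i') = 0)
  (hsize : (\big[minn/n]_(j < m) #|I n j|)%N @[n --> \oo] --> \oo)
  (hratio_cvg : forall j : 'I_m,
    cvg ((#|true_nulls_in (mu n) (I n j)|%:R / #|I n j|%:R : R) @[n --> \oo]))
  (hratio_min : 0 < \big[Num.min/1]_(j < m)
    lim ((#|true_nulls_in (mu n) (I n j)|%:R / #|I n j|%:R : R) @[n --> \oo])) :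
  (FWER (X n) (true_nulls_in (mu n) [set: 'I_n]%SET)
     (block_procedure (I n) beta rho)) @[n --> \oo] --> alpha%:E
  /\
  (P n (\bigcup_(j in [set: 'I_m])
          \bigcup_(i in [set` true_nulls_in (mu n) (I n j)])
            [set w | cutoff #|I n j| beta (rho j) < X n i w]))
    @[n --> \oo] --> alpha%:E.
Proof.
have [b01 bm] := sidak_level hm halpha; rewrite -hbeta in b01 bm.
pose A n : {set 'I_n} := true_nulls_in (mu n) [set: 'I_n]%SET.
have inA n i : (i \in A n) = (mu n i == 0) by rewrite !inE.
(* The blocks cover all indices, so the default [Ordinal hm] is never returned. *)
pose bl n (i : 'I_n) : 'I_m := odflt (Ordinal hm) [pick j | i \in I n j].
have blP n i j : (i \in I n j) = (bl n i == j).
  have ibl : i \in I n (bl n i).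
    rewrite /bl; case: pickP => //= noj.
    have : i \in [set: 'I_n]%SET by rewrite inE.
    rewrite -hcover => /bigcupP[j' _]. by move: (noj j') => ->.
  apply/idP/eqP => [ij|<-//]; apply/eqP; apply: contraT => /hdisj/disjointFr => /(_ _ _ ibl).
  by rewrite ij.
have blockE n j : block_nulls (A n) (bl n) j = true_nulls_in (mu n) (I n j).
  by apply/setP => i; rewrite !inE -blP andbC; congr (_ && _); rewrite inE.
pose cut n (j : 'I_m) : R := cutoff #|I n j| beta (rho j).
(* No true null is rejected; both events of the conclusion are the complement of this one. *)
pose Acc n := [set w | forall i, i \in A n -> X n i w <= cut n (bl n i)].
have mAcc n : measurable (Acc n).
  rewrite (_ : Acc n = \bigcap_(i in [set i | i \in A n]) [set w | X n i w <= cut n (bl n i)]).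
    apply: fin_bigcap_measurable => [|i _]; first exact: finite_finset.
    rewrite (_ : [set w | _] = X n i @^-1` [set` `]-oo, cut n (bl n i)]]).
      by rewrite -[Y in measurable Y]setTI; exact: (measurable_funP (X n i)).
    by apply/seteqP; split => w /=; rewrite in_itv/=.
  by apply/seteqP; split => w.
have rejE n : [set w | exists i, i \in A n /\
    i \in block_procedure (I n) beta rho (fun i' => X n i' w)] = ~` Acc n.
  apply/seteqP; split => w /=.
    move=> [i [iA]]; rewrite inE => /existsP[j /andP[]]; rewrite blP => /eqP <- Xi /(_ _ iA).
    by rewrite leNgt Xi.
  move=> /existsNP[i /not_implyP[iA /negP]]; rewrite -ltNge => Xi.
  exists i; split => //; rewrite inE; apply/existsP; exists (bl n i).
  by rewrite blP eqxx.
have unionE n : \bigcup_(j in [set: 'I_m]) \bigcup_(i in [set` true_nulls_in (mu n) (I n j)])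
    [set w | cutoff #|I n j| beta (rho j) < X n i w] = ~` Acc n.
  rewrite -rejE; apply/seteqP; split => w /=.
    move=> [j _ [i /=]]; rewrite inE => /andP[ij mi] Xi; exists i.
    by rewrite inA mi; split => //; rewrite inE; apply/existsP; exists j; rewrite ij.
  move=> [i [iA]]; rewrite inE => /existsP[j /andP[ij Xi]]; exists j => //; exists i => //=.
  by rewrite inE ij -inA.
suff cvgAcc : fine (P n (Acc n)) @[n --> \oo] --> 1 - alpha.
  have cvgC : P n (~` Acc n) @[n --> \oo] --> alpha%:E.
    have -> : (fun n => P n (~` Acc n)) = (fun n => (1 - fine (P n (Acc n)))%:E).
      apply/funext => n; rewrite probability_setC// EFinB fineK//.
      by rewrite fin_num_measure.
    apply/cvg_EFin; first exact: nearW.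
    rewrite (_ : alpha = 1 - (1 - alpha)); last by ring.
    by apply: cvgB => //; exact: cvg_cst.
  split; first by rewrite /FWER; under eq_fun do rewrite rejE.
  by under eq_fun do rewrite unionE.
pose k j n := #|I n j|; pose k0 j n := #|true_nulls_in (mu n) (I n j)|.
have k_oo j : k j n @[n --> \oo] --> \oo.
  apply/cvgnyPge => M; move/cvgnyPge/(_ M): hsize; apply: filterS => n /leq_trans; apply.
  by apply: bigmin_minn_le; rewrite mem_index_enum.
have k0_le j n : (k0 j n <= k j n)%N.
  by apply: subset_leq_card; apply/fintype.subsetP => i; rewrite inE => /andP[].
have lam_gt0 j : 0 < lim (((k0 j n)%:R / (k j n)%:R : R) @[n --> \oo]).
  by move/bigmin_gtP : hratio_min => [_]; apply.
have ratio j : ((k0 j n)%:R / (k j n)%:R : R) @[n --> \oo] -->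
  lim (((k0 j n)%:R / (k j n)%:R : R) @[n --> \oo]) by exact: hratio_cvg.
pose q j n := max_quantile R (k j n); pose delta j n := max_window R (k j n).
pose s j := Num.sqrt (1 - rho j).
(* Chosen so that s x + c y equals the cutoff exactly: e = - s goes with x = q + delta, and e = s
   with x = q - delta. *)
pose y e j n : R := (- (Num.sqrt (rho j) * Phi_inv beta) + e j * delta j n) /
  mean_coef (k0 j n) (rho j).
have cvg_prod_y e : \prod_j Phi (y e j n) @[n --> \oo] --> 1 - alpha.
  have -> : 1 - alpha = \prod_(j < m) (1 - beta) by rewrite prodr_const card_ord.
  apply: cvg_big_prod => j.
  exact: cvg_Phi_mean (k_oo j) (lam_gt0 j) (ratio j) (hrho j) b01 (e j).
have cvgL : \prod_j Phi (y (fun j => - s j) j n)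
   - \sum_j (k0 j n)%:R * (1 - Phi (q j n + delta j n)) @[n --> \oo] --> 1 - alpha.
  rewrite -[X in _ --> X]subr0; apply: cvgB; first exact: cvg_prod_y.
  apply: cvg_big_sum0 => j.
  exact: cvg_upper_tail (k_oo j) (k0_le j) (lam_gt0 j) (ratio j).
have cvgU : \prod_j Phi (y s j n)
   + \sum_j Phi (q j n - delta j n) ^+ k0 j n @[n --> \oo] --> 1 - alpha.
  rewrite -[X in _ --> X]addr0; apply: cvgD; first exact: cvg_prod_y.
  apply: cvg_big_sum0 => j.
  exact: cvg_lower_tail (k_oo j) (lam_gt0 j) (ratio j).
(* The block averages require a true null in every block. This holds eventually in each block, hence
   in all of the finitely many blocks at once. *)
have near_pos : \forall n \near \oo, forall j, (0 < k0 j n)%N.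
  apply: filter_forall => j.
  have : \forall n \near \oo, 0 < (k0 j n)%:R / (k j n)%:R :> R.
    by move/cvgr_gt: (ratio j); apply.
  apply: filterS => n; rewrite lt0n => h; apply/eqP => k00; move: h.
  by rewrite k00 mul0r ltxx.
apply: (squeeze_cvgr _ cvgL cvgU); near=> n.
have k0_gt0 : forall j, (0 < k0 j n)%N by near: n.
have lawX i : i \in A n -> has_normal_law (P n) (X n i) 0 1.
  by rewrite inA => /eqP <-; exact: hmarginal.
have corrX i l : i \in A n -> l \in A n -> i != l ->
    correlation (P n) (X n i) (X n l) = if bl n i == bl n l then rho (bl n i) else 0.
  move=> _ _ il; case: eqVneq => [bil|bil].
    by apply: hcorr_same => //; rewrite blP// bil.
  by apply: (hcorr_diff n (bl n i) (bl n l)) => //; rewrite blP.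
have A_neq0 j : (0 < #|block_nulls (A n) (bl n) j|)%N by rewrite blockE; exact: k0_gt0.
have cutE e j : mean_coef #|block_nulls (A n) (bl n) j| (rho j) * y e j n =
    - (Num.sqrt (rho j) * Phi_inv beta) + e j * delta j n.
  rewrite blockE /y mulrC divfK// gt_eqF// mean_coef_gt0//; exact: k0_gt0.
have PE : P n (Acc n) = (fine (P n (Acc n)))%:E by rewrite fineK// fin_num_measure.
apply/andP; split.
- have := @prob_accept_ge _ _ _ (P n) n m (X n) (A n) (bl n) rho (hgauss n) hrho
    lawX corrX A_neq0 (cut n) (fun j => q j n + delta j n) (fun j => y (fun j => - s j) j n).
  rewrite -/(Acc n) PE -EFinD lee_fin lerBlDr.
  under [\sum_j _]eq_bigr do rewrite blockE.
  apply => j; rewrite cutE /cut /cutoff -/(max_quantile R #|I n j|) -/(q j n) -/(s j)/=.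
  by lra.
- have := @prob_accept_le _ _ _ (P n) n m (X n) (A n) (bl n) rho (hgauss n) hrho
    lawX corrX A_neq0 (cut n) (fun j => q j n - delta j n) (fun j => y s j n).
  rewrite -/(Acc n) PE lee_fin.
  under [\sum_j _]eq_bigr do rewrite blockE.
  apply => j; rewrite cutE /cut /cutoff -/(max_quantile R #|I n j|) -/(q j n) -/(s j)/=.
  by lra.
Unshelve. all: by end_near. Qed.
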